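(* Let $\Psi_4\in\exp(\hat{\mathfrak f}_5)$ be the generalized associator for $4$th roots of unity, and let $s$ be the automorphism of $\hat{\mathfrak f}_5$ (and of $\exp(\hat{\mathfrak f}_5)$) induced by $$s: A\mapsto b[1],\quad b[1]\mapsto b[i],\quad b[i]\mapsto A,\quad b[-1]\mapsto b[-i],\quad b[-i]\mapsto C,\quad C\mapsto b[-1]$$ (all as defined in the context). Then $\Psi_4$ satisfies the following hexagon relation in $\exp(\hat{\mathfrak f}_5)$: $$(2/i)^{A}\, s^2(\Psi_4)\,(2/i)^{b[i]}\, s(\Psi_4)\,(2/i)^{b[1]}\,\Psi_4 = 1 .$$
   Context: Here $i=\sqrt{-1}$ and $\mu_4(\mathbb C)=\{1,i,-1,-i\}$. The Lie algebra $\mathfrak f_5$ is the complex Lie algebra with generators $A$, $C$, $b[\zeta]$ ($\zeta\in\mu_4(\mathbb C)$) and the only relation $A+\sum_{\zeta\in\mu_4(\mathbb C)}b[\zeta]+C=0$; thus it is free on $A$ and the $b[\zeta]$, with $C=-A-\sum_{\zeta}b[\zeta]$. It is graded with all generators in degree $1$; $\hat{\mathfrak f}_5$ is its degree completion and $\exp(\hat{\mathfrak f}_5)$ the associated prounipotent group. Convention: if $\mathfrak n$ is a pronilpotent Lie algebra, $x\in\mathfrak n$ and $a\in\mathbb C\setminus\mathbb R_-$, then $a^x:=\exp(x\ln(a))$, where $\ln(a)$ is chosen with imaginary part in $]-\pi,\pi[$. Definition of $\Psi_4$: consider the differential equation on $]0,1[$ $$(dH)H^{-1}=\Big(\frac{A}{z}+\sum_{\zeta\in\mu_4(\mathbb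 C)}\frac{b[\zeta]}{z-\zeta}\Big)dz$$ for functions $H$ with values in $\exp(\hat{\mathfrak f}_5)$. Let $H_0,H_1$ be the solutions such that $H_0(z)\simeq z^{A}$ when $z\to0^+$ and $H_1(z)\simeq(1-z)^{b[1]}$ when $z\to1^-$ (i.e. $H_0(z)z^{-A}\to1$ and $H_1(z)(1-z)^{-b[1]}\to1$ respectively). Then $\Psi_4:=H_1^{-1}H_0$, which is a constant element of $\exp(\hat{\mathfrak f}_5)$. *)

(* Defs.v *)
From HB Require Import structures.
From mathcomp Require Import all_boot all_order all_algebra complex.
From mathcomp Require Import all_classical all_reals all_analysis.
From mathcomp Require Import ring.

Set Implicit Arguments.
Unset Strict Implicit.
Unset Printing Implicit Defensive.

Import Order.TTheory GRing.Theory Num.Theory.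
Import numFieldNormedType.Exports.

Local Open Scope classical_set_scope.
Local Open Scope ring_scope.
Local Open Scope complex_scope.

(** * Noncommutative formal power series

    [ncs R L] is the algebra C<<L>> of noncommutative formal power series over
    the alphabet [L], a series being the family of its coefficients indexed by
    words. It is the degree completion of the free associative algebra, i.e. of
    the enveloping algebra of the free Lie algebra on [L]. *)

Definition ncs (R : realType) (L : finType) : Type := seq L -> R[i].

Section NcsRing.
Context (R : realType) (L : finType).
Implicit Types (f g h : ncs R L) (w : seq L).

HB.instance Definition _ := GRing.Lmodule.copy (ncs R L) (seq L -> R[i]).

Lemma ncs_addE f g w : (f + g) w = f w + g w. Proof. by []. Qed.
Lemma ncs_oppE f w : (- f) w = - f w. Proof. by []. Qed.
Lemma ncs_zeroE w : (0 : ncs R L) w = 0. Proof. by []. Qed.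
Lemma ncs_scaleE (a : R[i]) f w : (a *: f) w = a * f w. Proof. by []. Qed.

Lemma ncs_sumE (I : Type) (r : seq I) (P : pred I) (F : I -> ncs R L) w :
  (\sum_(i <- r | P i) F i) w = \sum_(i <- r | P i) F i w.
Proof.
elim: r => [|i r IHr]; first by rewrite !big_nil.
by rewrite !big_cons; case: ifP => _; rewrite ?ncs_addE IHr.
Qed.

Definition ncs_one : ncs R L := fun w => if w is [::] then 1 else 0.

Definition ncs_mul f g : ncs R L :=
  fun w => \sum_(k < (size w).+1) f (take k w) * g (drop k w).

Let ncs_mulA : associative ncs_mul.
Proof.
move=> f g h; apply/funext => w; rewrite /ncs_mul.
under eq_bigr => k _ do rewrite big_distrr/=.
under [RHS]eq_bigr => k _ do rewrite big_distrl/=.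
pose F (i j : nat) := f (take i w) * (g (take j (drop i w)) *
  h (drop (i + j) w)).
have -> : \sum_(i < (size w).+1) \sum_(j < (size (drop i w)).+1)
    f (take i w) * (g (take j (drop i w)) * h (drop j (drop i w))) =
  \sum_(i < (size w).+1) \sum_(k < (size w).+1 | (i <= k)%N) F i (k - i)%N.
  apply: eq_bigr => i _; rewrite size_drop.
  rewrite -(big_mkord xpredT (fun j => f (take i w) *
    (g (take j (drop i w)) * h (drop j (drop i w))))).
  rewrite -(big_mkord (fun k => (i <= k)%N) (fun k => F i (k - i)%N)).
  have iw : (i <= size w)%N by rewrite -ltnS.
  rewrite [RHS](big_cat_nat _ (n := i))//=; last exact: leqW.
  rewrite [X in _ = X + _]big_nat_cond [X in _ = X + _]big_pred0 ?add0r;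
    last first.
    by move=> k; case: ltnP => //=; rewrite ?andbF.
  rewrite [RHS](_ : _ = \sum_(0 + i <= k < (size w).+1 | (i <= k)%N)
    F i (k - i)%N)// big_addn subSn//.
  apply: eq_big => [j|j _]; first by rewrite leq_addl.
  by rewrite /F addnK drop_drop addnC.
rewrite (exchange_big_dep xpredT)//=; apply: eq_bigr => k _.
have kw : (k <= size w)%N by rewrite -ltnS.
rewrite size_takel//.
rewrite -(big_mkord (fun i => (i <= k)%N) (fun i => F i (k - i)%N)).
rewrite -(big_mkord xpredT (fun i => f (take i (take k w)) *
    g (drop i (take k w)) * h (drop k w))).
rewrite (big_cat_nat _ (n := k.+1))//=.
rewrite [X in _ + X]big_nat_cond [X in _ + X]big_pred0 ?addr0; last first.
  by move=> i; case: ltnP => //=; rewrite ?andbF.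
rewrite big_nat_cond [RHS]big_nat_cond.
apply: eq_big => [i|i /andP[/andP[_ ik] _]].
  by rewrite leq0n/= ltnS andbb andbT.
rewrite ltnS in ik.
by rewrite /F subnKC// take_takel// mulrA take_drop subnK.
Qed.

Let ncs_mul1l : left_id ncs_one ncs_mul.
Proof.
move=> f; apply/funext => w; rewrite /ncs_mul big_ord_recl take0 drop0 mul1r.
rewrite big1 ?addr0// => k _; case: w k => [[]//|a w] k /=.
by rewrite mul0r.
Qed.

Let ncs_mul1r : right_id ncs_one ncs_mul.
Proof.
move=> f; apply/funext => w; rewrite /ncs_mul big_ord_recr/= take_size.
rewrite drop_size mulr1 big1 ?add0r// => k _.
case E : (drop k w) => [|//]; last by rewrite mulr0.
have := size_drop k w; rewrite E/= => /esym/eqP.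
by rewrite subn_eq0 leqNgt ltn_ord.
Qed.

Let ncs_mulDl : left_distributive ncs_mul +%R.
Proof.
move=> f g h; apply/funext => w; rewrite ncs_addE /ncs_mul -big_split/=.
by apply: eq_bigr => k _; rewrite ncs_addE mulrDl.
Qed.

Let ncs_mulDr : right_distributive ncs_mul +%R.
Proof.
move=> f g h; apply/funext => w; rewrite ncs_addE /ncs_mul -big_split/=.
by apply: eq_bigr => k _; rewrite ncs_addE mulrDr.
Qed.

Let ncs_oner_neq0 : ncs_one != 0.
Proof.
by apply/eqP => /(congr1 (fun f : ncs R L => f [::]))/eqP; rewrite oner_eq0.
Qed.

HB.instance Definition _ := GRing.Zmodule_isNzRing.Build (ncs R L)
  ncs_mulA ncs_mul1l ncs_mul1r ncs_mulDl ncs_mulDr ncs_oner_neq0.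

Lemma ncs_mulE f g w :
  (f * g) w = \sum_(k < (size w).+1) f (take k w) * g (drop k w).
Proof. by []. Qed.

Lemma ncs_oneE w : (1 : ncs R L) w = if w is [::] then 1 else 0.
Proof. by []. Qed.

Let ncs_scaleAl (a : R[i]) f g : a *: (f * g) = (a *: f) * g.
Proof.
apply/funext => w; rewrite ncs_scaleE !ncs_mulE big_distrr/=.
by apply: eq_bigr => k _; rewrite ncs_scaleE mulrA.
Qed.

HB.instance Definition _ :=
  GRing.Lmodule_isLalgebra.Build R[i] (ncs R L) ncs_scaleAl.

Let ncs_scaleAr (a : R[i]) f g : a *: (f * g) = f * (a *: g).
Proof.
apply/funext => w; rewrite ncs_scaleE !ncs_mulE big_distrr/=.
by apply: eq_bigr => k _; rewrite ncs_scaleE mulrCA.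
Qed.

HB.instance Definition _ :=
  GRing.Lalgebra_isAlgebra.Build R[i] (ncs R L) ncs_scaleAr.

Lemma ncs_mul_nil f g : (f * g) [::] = f [::] * g [::].
Proof. by rewrite ncs_mulE big_ord1. Qed.

Lemma ncs_expr_small f n w : f [::] = 0 -> (size w < n)%N -> (f ^+ n) w = 0.
Proof.
move=> f0; elim: n w => // n IHn w wn; rewrite exprS ncs_mulE big1// => k _.
case: (posnP k) => [->|k0]; first by rewrite take0 f0 mul0r.
rewrite IHn ?mulr0// size_drop -ltnS (leq_trans _ wn)// ltnS.
by case: w k k0 {wn} => [|a w] [[|k]//= ?] _; rewrite ?subSS ltnS leq_subr.
Qed.

(* The invertible series are those with nonzero constant term; the inverse is
   the geometric series, which is a finite sum in each word. *)
Definition ncs_unit : pred (ncs R L) := [pred f : ncs R L | f [::] != 0].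

Definition ncs_inv f : ncs R L :=
  if ncs_unit f then
    fun w => (f [::])^-1 *
      \sum_(n < (size w).+1) ((1 - (f [::])^-1 *: f) ^+ n) w
  else f.

Let ncs_inv_trunc f w N : ncs_unit f -> (size w < N)%N ->
  ncs_inv f w = ((f [::])^-1 *: \sum_(n < N) (1 - (f [::])^-1 *: f) ^+ n) w.
Proof.
move=> uf wN; rewrite /ncs_inv uf ncs_scaleE ncs_sumE; congr (_ * _).
pose G n := ((1 - (f [::])^-1 *: f) ^+ n) w.
rewrite -(big_mkord xpredT G) -[RHS](big_mkord xpredT G).
rewrite [RHS](big_cat_nat _ (n := (size w).+1))//=.
rewrite [X in _ = _ + X]big_nat_cond [X in _ = _ + X]big1 ?addr0// => n.
move=> /andP[/andP[wn _] _]; apply: ncs_expr_small => //.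
by rewrite ncs_addE ncs_oppE ncs_scaleE mulVf ?subrr.
Qed.

Let ncs_geom f N (g := 1 - (f [::])^-1 *: f) : ncs_unit f ->
  f * ((f [::])^-1 *: \sum_(n < N) g ^+ n) = 1 - g ^+ N /\
  ((f [::])^-1 *: \sum_(n < N) g ^+ n) * f = 1 - g ^+ N.
Proof.
move=> uf.
have Ef : (f [::])^-1 *: f = 1 - g by rewrite /g opprB addrC subrK.
have com : (1 - g) * (\sum_(n < N) g ^+ n) = (\sum_(n < N) g ^+ n) * (1 - g).
  rewrite mulrBl mulrBr mul1r mulr1; congr (_ - _).
  rewrite big_distrl big_distrr/=.
  by apply: eq_bigr => n _; rewrite -exprS -exprSr.
rewrite -scalerAr scalerAl -[(_ *: \sum_(n < N) _) * f]scalerAl scalerAr Ef.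
by rewrite -com -opprB mulNr -subrX1 opprB.
Qed.

Let ncs_g0 f N w : ncs_unit f -> (size w < N)%N ->
  (1 - (1 - (f [::])^-1 *: f) ^+ N) w = (1 : ncs R L) w.
Proof.
move=> uf wN; rewrite ncs_addE ncs_oppE ncs_expr_small ?subr0//.
by rewrite ncs_addE ncs_oppE ncs_scaleE mulVf ?subrr.
Qed.

Let ncs_mulVr : {in ncs_unit, left_inverse 1 ncs_inv *%R}.
Proof.
move=> f uf; apply/funext => w.
rewrite -(ncs_g0 uf (ltnSn (size w))) -(ncs_geom _ uf).2 !ncs_mulE.
apply: eq_bigr => k _; congr (_ * _); apply: ncs_inv_trunc => //.
by rewrite size_take ltnS; case: ltnP => // /ltnW.
Qed.

Let ncs_mulrV : {in ncs_unit, right_inverse 1 ncs_inv *%R}.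
Proof.
move=> f uf; apply/funext => w.
rewrite -(ncs_g0 uf (ltnSn (size w))) -(ncs_geom _ uf).1 !ncs_mulE.
apply: eq_bigr => k _; congr (_ * _); apply: ncs_inv_trunc => //.
by rewrite size_drop ltnS leq_subr.
Qed.

Let ncs_unitP f g : g * f = 1 /\ f * g = 1 -> ncs_unit f.
Proof.
move=> [/(congr1 (fun h : ncs R L => h [::]))]; rewrite ncs_mul_nil ncs_oneE.
move=> gf _; rewrite /ncs_unit/=; apply/eqP => f0.
by move/eqP: gf; rewrite f0 mulr0 eq_sym oner_eq0.
Qed.

Let ncs_inv_out : {in [predC ncs_unit], ncs_inv =1 id}.
Proof. by move=> f; rewrite inE => /negbTE uf; rewrite /ncs_inv [ncs_unit f]uf. Qed.

HB.instance Definition _ := GRing.NzRing_hasMulInverse.Build (ncs R L)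
  ncs_mulVr ncs_mulrV ncs_unitP ncs_inv_out.

End NcsRing.

Section NcsTheory.
Context (R : realType) (L : finType).

Definition ncs_letter (l : L) : ncs R L := fun w => (w == [:: l])%:R.

(* Exponential of a series without constant term: as a word [w] has coefficient
   zero in [x ^+ n] for [n > size w], the sum is truncated there. *)
Definition ncs_exp (x : ncs R L) : ncs R L :=
  fun w => \sum_(n < (size w).+1) (n`!%:R)^-1 * (x ^+ n) w.

(* Continuous algebra endomorphism sending each letter [l] to [sigma l], where
   the [sigma l] have no constant term: the coefficient at [w] of
   \sum_u (f u) *: \prod_(l <- u) sigma l, to which only the words [u] with
   [size u <= size w] contribute. *)
Definition ncs_subst (sigma : L -> ncs R L) (f : ncs R L) : ncs R L :=
  fun w => \sum_(n < (size w).+1) \sum_(u : n.-tuple L)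
    f u * (\prod_(l <- u) sigma l) w.

Lemma ncs_substD sigma f g :
  ncs_subst sigma (f + g) = ncs_subst sigma f + ncs_subst sigma g.
Proof.
apply/funext => w; rewrite ncs_addE /ncs_subst -big_split/=.
apply: eq_bigr => n _; rewrite -big_split/=.
by apply: eq_bigr => u _; rewrite ncs_addE mulrDl.
Qed.

Lemma ncs_substN sigma f : ncs_subst sigma (- f) = - ncs_subst sigma f.
Proof.
apply/funext => w; rewrite ncs_oppE /ncs_subst -sumrN.
apply: eq_bigr => n _; rewrite -sumrN.
by apply: eq_bigr => u _; rewrite ncs_oppE mulNr.
Qed.

Lemma ncs_subst_letter sigma l : sigma l [::] = 0 ->
  ncs_subst sigma (ncs_letter l) = sigma l.
Proof.
move=> sl0; apply/funext => w; rewrite /ncs_subst.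
have u0 (n : nat) (u : n.-tuple L) : n != 1%N -> ncs_letter l u = 0.
  move=> n1; rewrite /ncs_letter; case: eqP => // /(congr1 size)/eqP.
  by rewrite size_tuple/= (negbTE n1).
case: w => [|a w].
  by rewrite big_ord1 sl0 big1// => u _; rewrite u0// mul0r.
rewrite /= 2!big_ord_recl big1 ?add0r => [|u _]; last by rewrite u0 ?mul0r.
rewrite [X in _ + X]big1 ?addr0 => [|k _]; last first.
  by rewrite big1// => u _; rewrite u0 ?mul0r.
rewrite (bigD1 [tuple l])//= [X in _ + X]big1 ?addr0 => [|u ul].
  by rewrite /ncs_letter eqxx mul1r big_seq1.
by rewrite /ncs_letter -[[:: l]]/(val [tuple l]) val_eqE (negbTE ul) mul0r.
Qed.

(* The free Lie algebra on [L], realized as the Lie subalgebra of the free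
   associative algebra generated by the letters. *)
Inductive free_lie : ncs R L -> Prop :=
| free_lie_letter l : free_lie (ncs_letter l)
| free_lie_zero : free_lie 0
| free_lie_add x y : free_lie x -> free_lie y -> free_lie (x + y)
| free_lie_scale (a : R[i]) x : free_lie x -> free_lie (a *: x)
| free_lie_bracket x y : free_lie x -> free_lie y -> free_lie (x * y - y * x).

Definition ncs_homog (n : nat) (x : ncs R L) : ncs R L :=
  fun w => if size w == n then x w else 0.

(* Degree completion of [free_lie]. *)
Definition free_lie_hat : set (ncs R L) :=
  [set x | forall n, free_lie (ncs_homog n x)].

Definition exp_free_lie_hat : set (ncs R L) := ncs_exp @` free_lie_hat.

(* Derivative and limit of functions of a real variable with values in series:
   coefficientwise, C being identified with R^2. *)
Definition ncs_is_derive (H : R -> ncs R L) (z : R) (D : ncs R L) : Prop :=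
  forall w, is_derive z 1 (fun t => complex.Re (H t w)) (complex.Re (D w)) /\
            is_derive z 1 (fun t => complex.Im (H t w)) (complex.Im (D w)).

Definition ncs_cvg (H : R -> ncs R L) (F : set_system R) (l : ncs R L) : Prop :=
  forall w, complex.Re (H t w) @[t --> F] --> complex.Re (l w) /\
            complex.Im (H t w) @[t --> F] --> complex.Im (l w).

End NcsTheory.

Section ComplexPower.
Context (R : realType).

Definition cexp (l : R[i]) : R[i] :=
  (expR (complex.Re l))%:C * (cos (complex.Im l) +i* sin (complex.Im l)).

(* Principal logarithm: the logarithm of [a] with imaginary part in ]-pi, pi[,
   which exists and is unique for [a] outside the nonpositive reals (outside
   this domain, [cln a] is a junk value). *)
Definition cln (a : R[i]) : R[i] :=
  xget 0 [set l : R[i] | cexp l = a /\ - pi < complex.Im l < pi].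

Definition cpow_ncs (L : finType) (a : R[i]) (x : ncs R L) : ncs R L :=
  ncs_exp (cln a *: x).

End ComplexPower.

(** * The Lie algebra f_5 and the associator

    The free generators of f_5 are [None], for A, and [Some k], for b[i^k];
    thus b[1], b[i], b[-1], b[-i] are [Some k] for k = 0, 1, 2, 3. *)

Definition f5_letter : finType := option 'I_4.

Section F5.
Context (R : realType).

Local Notation series := (ncs R f5_letter).

Definition f5_A : series := ncs_letter R (None : f5_letter).
Definition f5_b (k : 'I_4) : series := ncs_letter R (Some k : f5_letter).
Definition f5_C : series := - f5_A - \sum_(k < 4) f5_b k.

Definition mu4 (k : 'I_4) : R[i] := 'i%C ^+ k.

Definition f5_b1 : series := f5_b (inord 0).
Definition f5_bi : series := f5_b (inord 1).
Definition f5_bm1 : series := f5_b (inord 2).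
Definition f5_bmi : series := f5_b (inord 3).

Definition exp_f5_hat : set series := @exp_free_lie_hat R f5_letter.

Definition f5_connection (z : R) : series :=
  (z%:C)^-1 *: f5_A + \sum_(k < 4) (z%:C - mu4 k)^-1 *: f5_b k.

Definition f5_solution (H : R -> series) : Prop :=
  forall z : R, 0 < z < 1 ->
    exp_f5_hat (H z) /\
    exists2 dH, ncs_is_derive H z dH & dH * (H z)^-1 = f5_connection z.

Definition is_H0 (H : R -> series) : Prop :=
  f5_solution H /\
  ncs_cvg (fun z => H z * cpow_ncs (z%:C) (- f5_A)) 0^'+ 1.

Definition is_H1 (H : R -> series) : Prop :=
  f5_solution H /\
  ncs_cvg (fun z => H z * cpow_ncs ((1 - z)%:C) (- f5_b1)) 1^'- 1.

Definition f5_s_letter (l : f5_letter) : series :=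
  match l with
  | None => f5_b1
  | Some k => nth 0 [:: f5_bi; f5_A; f5_bmi; f5_C] k
  end.

Definition f5_s : series -> series := ncs_subst f5_s_letter.

Lemma f5_s_C : f5_s f5_C = f5_bm1.
Proof.
have l0 l : f5_s_letter l [::] = 0.
  case: l => [[[|[|[|[|//]]]] ?]|]//=.
  by rewrite /f5_C !(ncs_addE, ncs_oppE) ncs_sumE big1// !(subr0, oppr0).
have sA : f5_s f5_A = f5_b1 by exact: ncs_subst_letter.
have sb k : f5_s (f5_b k) = f5_s_letter (Some k) by exact: ncs_subst_letter.
have sB : f5_s (\sum_(k < 4) f5_b k) = \sum_(k < 4) f5_s (f5_b k).
  by rewrite !big_ord_recl !big_ord0 !addr0 /f5_s !ncs_substD.
rewrite /f5_C /f5_s !(ncs_substD, ncs_substN) -!/(f5_s _) sA sB.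
have sum4 (F : 'I_4 -> series) : \sum_(k < 4) F k =
    F (inord 0) + F (inord 1) + F (inord 2) + F (inord 3).
  rewrite !big_ord_recr big_ord0/= add0r.
  by congr (F _ + F _ + F _ + F _); apply/val_inj; rewrite /= inordK.
rewrite sum4 !sb /f5_s_letter !inordK//= /f5_C sum4.
apply/funext => w; rewrite !(ncs_addE, ncs_oppE) -/f5_b1 -/f5_bi -/f5_bm1 -/f5_bmi.
ring.
Qed.

End F5.

(* Main.v *)
Require Import Defs.
From mathcomp Require Import all_boot all_order all_algebra complex.
From mathcomp Require Import all_classical all_reals all_analysis.
From mathcomp Require Import ring lra.

Set Implicit Arguments.
Unset Strict Implicit.
Unset Printing Implicit Defensive.

Import Order.TTheory GRing.Theory Num.Theory.
Import numFieldNormedType.Exports Normc.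
Local Open Scope classical_set_scope.
Local Open Scope ring_scope.
Local Open Scope complex_scope.

(** The relation expresses that the connection is flat inside the triangle with
    vertices 0, 1, i cut out by the real axis, the unit circle and the imaginary
    axis. Let sigma be the Moebius map of order 3 with 0 -> 1 -> i -> 0,
    -1 -> -i -> oo -> -1. It permutes the singular points as [f5_s] permutes the
    residues, so [f5_s] carries solutions composed with sigma^-1 to solutions
    ([s_f5_conn]).

    The solution H_0 extends to [K0 w = F(w) exp(A log w)], where F is
    holomorphic on the unit disc and F(0) = 1 ([hol]); then
    [K1 w = f5_s (K0 (sigma^-1 w))] is again a solution, and comparing
    asymptotics at 0 and at 1 gives H_0 = K0 and H_1 = K1 (2/i)^b[1] on ]0,1[
    ([H0_eq_K0], [H1_eq_K1]); the factor comes from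
    sigma^-1(x) = i (1 - x) / (1 + x), of modulus (1 - x) / (1 + x) and argument
    pi / 2. Hence (2/i)^b[1] Psi_4 = K1^-1 K0 on ]0,1[. The right-hand side is
    constant along any path in the open right half of the unit disc, so it can
    be computed at the fixed point p of sigma, where K1 p = f5_s (K0 p). With
    g = K0 p this yields (2/i)^b[1] Psi_4 = (f5_s g)^-1 g ([Psi4E]). Applying
    [f5_s] twice, and using that its cube is the identity, the three factors of
    the hexagon become g^-1 s^2(g), s^2(g)^-1 s(g) and s(g)^-1 g, whose product
    telescopes to 1.

    The analysis is that of complex-valued functions of one real variable: power
    series are differentiated along real paths, and uniqueness for the
    differential equation is an induction on the length of words, since the coefficient at l w of [f5_conn z * K] only involves the
    coefficient of K at w. *)

(** * Noncommutative series: tails, substitution, exponentials *)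

Section SeriesAlgebra.
Context (R : realType) (L : finType).
Implicit Types (f g h x : ncs R L) (w v : seq L) (l : L).

Definition ncs_tail l f : ncs R L := fun w => f (l :: w).

Lemma ncs_mul_cons f g l w :
  (f * g) (l :: w) = f [::] * g (l :: w) + (ncs_tail l f * g) w.
Proof. by rewrite !ncs_mulE big_ord_recl take0 drop0. Qed.

Lemma ncs_tailM l f g :
  ncs_tail l (f * g) = f [::] *: ncs_tail l g + ncs_tail l f * g.
Proof. by apply/funext => w; rewrite /ncs_tail ncs_mul_cons. Qed.

(** A left factor without constant term consumes at least one letter. This is
    what makes the inductions on the length of words below work. *)
Lemma ncs_mul_local x g h w : x [::] = 0 ->
  (forall v, (size v < size w)%N -> g v = h v) -> (x * g) w = (x * h) w.
Proof.
move=> x0 gh; case: w gh => [|l w] gh; first by rewrite !ncs_mul_nil x0 !mul0r.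
rewrite !ncs_mul_cons x0 !mul0r !add0r !ncs_mulE.
apply: eq_bigr => k _; rewrite gh//= size_drop ltnS leq_subr//.
Qed.

Lemma ncs_tail_letter l l' : ncs_tail l (ncs_letter R l') = (l == l')%:R *: 1.
Proof.
apply/funext => w; rewrite /ncs_tail /ncs_letter ncs_scaleE ncs_oneE eqseq_cons.
by case: w => [|? ?]; rewrite ?andbT ?andbF ?mulr1 ?mulr0.
Qed.

Lemma ncs_letter_mul_cons l f l' w :
  (ncs_letter R l * f) (l' :: w) = (l' == l)%:R * f w.
Proof.
by rewrite ncs_mul_cons mul0r add0r ncs_tail_letter -scalerAl mul1r ncs_scaleE.
Qed.

Lemma ncs_mul_letter_rcons f l w l' :
  (f * ncs_letter R l) (rcons w l') = f w * (l' == l)%:R.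
Proof.
rewrite ncs_mulE big_ord_recr/= take_size drop_size mulr0 addr0 size_rcons.
rewrite big_ord_recr/= big1 ?add0r => [|k _].
  rewrite -{1}cats1 take_size_cat// drop_rcons// drop_size/=.
  by rewrite /ncs_letter eqseq_cons andbT.
rewrite drop_rcons ?(ltnW (ltn_ord k))//= /ncs_letter.
case: eqP => [/(congr1 size)/=|]; last by rewrite mulr0.
rewrite size_rcons size_drop => -[/eqP].
by rewrite subn_eq0 leqNgt ltn_ord.
Qed.

Lemma ncs_decomp f :
  f = f [::] *: 1 + \sum_l ncs_letter R l * ncs_tail l f.
Proof.
apply/funext => -[|l w]; rewrite ncs_addE ncs_scaleE ncs_sumE ncs_oneE.
  by rewrite mulr1 big1 ?addr0// => l _; rewrite ncs_mul_nil mul0r.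
rewrite mulr0 add0r (bigD1 l)//= big1 => [|l' l'l].
  by rewrite ncs_letter_mul_cons eqxx mul1r addr0.
by rewrite ncs_letter_mul_cons eq_sym (negbTE l'l) mul0r.
Qed.

Lemma ncs_unitE f : f [::] = 1 -> f \is a GRing.unit.
Proof. by move=> f1; rewrite unfold_in /= /ncs_unit/= f1 oner_neq0. Qed.

End SeriesAlgebra.

Section Substitution.
Context (R : realType) (L : finType) (s : L -> ncs R L).
Hypothesis s0 : forall l, s l [::] = 0.
Implicit Types (f g h x : ncs R L) (w v : seq L) (l : L).

Lemma ncs_prod_small (u : seq L) w : (size w < size u)%N ->
  (\prod_(l <- u) s l) w = 0.
Proof.
elim: u w => // l u IH w wu; rewrite big_cons.
rewrite (@ncs_mul_local _ _ _ _ 0)// => [|v vw]; first by rewrite mulr0.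
by rewrite IH// (leq_trans vw).
Qed.

Lemma ncs_subst_trunc f w N : (size w < N)%N -> ncs_subst s f w =
  (\sum_(n < N) \sum_(u : n.-tuple L) f u *: \prod_(l <- u) s l) w.
Proof.
move=> wN; rewrite /ncs_subst ncs_sumE.
under [RHS]eq_bigr => n _ do rewrite ncs_sumE.
pose G n := \sum_(u : n.-tuple L) f u * (\prod_(l <- u) s l) w.
rewrite -(big_mkord xpredT G) -[RHS](big_mkord xpredT G).
rewrite [RHS](big_cat_nat _ (n := (size w).+1))//=.
rewrite [X in _ = _ + X]big_nat_cond [X in _ = _ + X]big1 ?addr0// => n.
move=> /andP[/andP[wn _] _]; rewrite /G big1// => u _.
by rewrite ncs_prod_small ?mulr0 ?size_tuple.
Qed.

Lemma big_tuple_cons (V : nmodType) m (F : seq L -> V) :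
  \sum_(u : m.+1.-tuple L) F u = \sum_l \sum_(u : m.-tuple L) F (l :: u).
Proof.
rewrite pair_big/= (reindex (fun p : L * m.-tuple L => [tuple of p.1 :: p.2]))//=.
exists (fun u : m.+1.-tuple L => (thead u, [tuple of behead u])).
  by move=> [l u] _; congr (_, _); apply/val_inj.
by move=> u _; rewrite [in RHS](tuple_eta u).
Qed.

(** Splitting off the first letter of each word turns the substitution into a
    recursion, from which its algebraic properties follow by induction on the
    length of words. *)
Lemma ncs_substE f :
  ncs_subst s f = f [::] *: 1 + \sum_l s l * ncs_subst s (ncs_tail l f).
Proof.
apply/funext => w; rewrite (@ncs_subst_trunc _ _ (size w).+1)// big_ord_recl/=.
rewrite !ncs_addE; congr (_ + _).
  rewrite (big_pred1 [tuple]) ?big_nil// => u.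
  by symmetry; apply/eqP; exact: tuple0.
transitivity ((\sum_(n < size w) \sum_l \sum_(u : n.-tuple L)
    f (l :: u) *: \prod_(l' <- l :: u) s l') w).
  congr (_ w); apply: eq_bigr => n _.
  exact: (big_tuple_cons n (fun u => f u *: \prod_(l <- u) s l)).
rewrite exchange_big/= !ncs_sumE; apply: eq_bigr => l _.
rewrite (@ncs_mul_local _ _ _ _ (\sum_(n < size w) \sum_(u : n.-tuple L)
   ncs_tail l f u *: \prod_(l <- u) s l))// => [|v vw]; last first.
  exact: ncs_subst_trunc.
rewrite mulr_sumr; congr (_ w); apply: eq_bigr => n _.
rewrite mulr_sumr; apply: eq_bigr => u _.
by rewrite big_cons -scalerAr.
Qed.

Lemma ncs_subst_nil f : ncs_subst s f [::] = f [::].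
Proof.
rewrite ncs_substE ncs_addE ncs_scaleE mulr1 ncs_sumE big1 ?addr0// => l _.
by rewrite ncs_mul_nil s0 mul0r.
Qed.

Lemma ncs_subst_local f g w : (forall v, (size v <= size w)%N -> f v = g v) ->
  ncs_subst s f w = ncs_subst s g w.
Proof.
move=> fg; apply: eq_bigr => n _; apply: eq_bigr => u _.
by rewrite fg// size_tuple -ltnS.
Qed.

Lemma ncs_substZ a f : ncs_subst s (a *: f) = a *: ncs_subst s f.
Proof.
apply/funext => w; rewrite ncs_scaleE /ncs_subst mulr_sumr.
apply: eq_bigr => n _; rewrite mulr_sumr; apply: eq_bigr => u _.
by rewrite ncs_scaleE mulrA.
Qed.

Lemma ncs_subst0 : ncs_subst s 0 = 0.
Proof. by have := ncs_substZ 0 0; rewrite !scale0r. Qed.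

Lemma ncs_subst1 : ncs_subst s 1 = 1.
Proof.
rewrite ncs_substE ncs_oneE scale1r big1 ?addr0// => l _.
have -> : ncs_tail l 1 = 0 :> ncs R L by apply/funext.
by rewrite ncs_subst0 mulr0.
Qed.

Lemma ncs_subst_sum (I : Type) (r : seq I) (P : pred I) (F : I -> ncs R L) :
  ncs_subst s (\sum_(i <- r | P i) F i) = \sum_(i <- r | P i) ncs_subst s (F i).
Proof.
elim: r => [|i r IH]; first by rewrite !big_nil ncs_subst0.
by rewrite !big_cons; case: ifP => _; rewrite ?ncs_substD IH.
Qed.

(** By [ncs_substE] both sides satisfy the same recursion: the tail of a product
    is given by [ncs_tailM], and the tails enter multiplied by [s l], which has
    no constant term. *)
Lemma ncs_substM f g : ncs_subst s (f * g) = ncs_subst s f * ncs_subst s g.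
Proof.
apply/funext => w; have [n] := ubnP (size w).
elim: n f g w => // n IH f g w wn.
rewrite ncs_substE ncs_mul_nil.
under eq_bigr => l _ do rewrite ncs_tailM ncs_substD ncs_substZ mulrDr -scalerAr.
rewrite big_split/= -scaler_sumr addrA -scalerA -scalerDr -ncs_substE.
rewrite [ncs_subst s f]ncs_substE mulrDl -scalerAl mul1r mulr_suml.
rewrite !ncs_addE; congr (_ + _); rewrite !ncs_sumE; apply: eq_bigr => l _.
rewrite -mulrA; apply: ncs_mul_local => // v vw; apply: IH.
by rewrite (leq_trans vw).
Qed.

Lemma ncs_substX f n : ncs_subst s (f ^+ n) = ncs_subst s f ^+ n.
Proof.
by elim: n => [|n IH]; rewrite ?ncs_subst1// !exprS ncs_substM IH.
Qed.

Lemma ncs_substV f : f [::] = 1 -> ncs_subst s f^-1 = (ncs_subst s f)^-1.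
Proof.
move=> f1; have sf1 : ncs_subst s f [::] = 1 by rewrite ncs_subst_nil.
apply: (mulrI (ncs_unitE sf1)).
by rewrite (mulrV (ncs_unitE sf1)) -ncs_substM mulrV ?ncs_subst1//; exact: ncs_unitE.
Qed.

Lemma ncs_exp_trunc x w N : x [::] = 0 -> (size w < N)%N ->
  ncs_exp x w = (\sum_(n < N) (n`!%:R)^-1 *: x ^+ n) w.
Proof.
move=> x0 wN; rewrite /ncs_exp ncs_sumE.
pose G n := (n`!%:R)^-1 * (x ^+ n) w.
rewrite -(big_mkord xpredT G) -[RHS](big_mkord xpredT G).
rewrite [RHS](big_cat_nat _ (n := (size w).+1))//=.
rewrite [X in _ = _ + X]big_nat_cond [X in _ = _ + X]big1 ?addr0// => n.
by move=> /andP[/andP[wn _] _]; rewrite /G ncs_expr_small ?mulr0.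
Qed.

Lemma ncs_subst_exp x : x [::] = 0 ->
  ncs_subst s (ncs_exp x) = ncs_exp (ncs_subst s x).
Proof.
move=> x0; apply/funext => w.
rewrite (@ncs_exp_trunc (ncs_subst s x) _ (size w).+1) ?ncs_subst_nil//.
rewrite (@ncs_subst_local _ (\sum_(n < (size w).+1) (n`!%:R)^-1 *: x ^+ n)); last first.
  by move=> v vw; rewrite -ncs_exp_trunc.
rewrite ncs_subst_sum; congr (_ w); apply: eq_bigr => n _.
by rewrite ncs_substZ ncs_substX.
Qed.

End Substitution.

(** An endomorphism is determined by its values on letters: the recursion
    [ncs_substE] and the decomposition [ncs_decomp] of [f] agree term by term. *)
Lemma ncs_subst_order3 (R : realType) (L : finType) (s : L -> ncs R L) :
  (forall l, s l [::] = 0) ->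
  (forall l, ncs_subst s (ncs_subst s (s l)) = ncs_letter R l) ->
  forall f, ncs_subst s (ncs_subst s (ncs_subst s f)) = f.
Proof.
move=> s0 s3 f; apply/funext => w; have [n] := ubnP (size w).
elim: n f w => // n IH f w wn.
rewrite (ncs_substE s0 f) ncs_substD ncs_substD !ncs_substZ.
rewrite !(ncs_subst1 s0) !(ncs_subst_sum s) [in RHS](ncs_decomp f).
rewrite !ncs_addE; congr (_ + _); rewrite !ncs_sumE; apply: eq_bigr => l _.
rewrite !(ncs_substM s0) s3; apply: ncs_mul_local => // v vw; apply: IH.
by rewrite (leq_trans vw).
Qed.

Section LetterExp.
Context (R : realType) (L : finType).
Implicit Types (l : L) (c d : R[i]) (w : seq L).

(** Closed form of the exponential of [c *: ncs_letter R l]: the entry at l^n is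
    c^n / n!. *)
Definition letter_exp l c : ncs R L :=
  fun w => if all (pred1 l) w then c ^+ size w / (size w)`!%:R else 0.

Lemma ncs_letterX l n w :
  (ncs_letter R l ^+ n) w = ((size w == n) && all (pred1 l) w)%:R.
Proof.
elim: n w => [|n IH] [|l' w]; rewrite ?expr0 ?ncs_oneE//= exprS.
  by rewrite ncs_mul_nil mul0r.
by rewrite ncs_letter_mul_cons IH eqSS/= andbCA; case: eqP; rewrite ?mul1r ?mul0r.
Qed.

Lemma ncs_exp_letter l c : ncs_exp (c *: ncs_letter R l) = letter_exp l c.
Proof.
apply/funext => w; rewrite /ncs_exp /letter_exp big_ord_recr/= big1 ?add0r.
  rewrite exprZn ncs_scaleE ncs_letterX eqxx/=.
  by case: all; rewrite ?mulr1 ?mulr0// mulrC.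
move=> n _; rewrite exprZn ncs_scaleE ncs_letterX gtn_eqF ?mulr0//.
Qed.

Lemma letter_exp_nil l c : letter_exp l c [::] = 1.
Proof. by rewrite /letter_exp/= expr0 divr1. Qed.

Lemma letter_exp0 l : letter_exp l 0 = 1.
Proof.
apply/funext => -[|a w]; first by rewrite letter_exp_nil.
by rewrite /letter_exp/= expr0n mul0r if_same.
Qed.

Lemma letter_expD l c d : letter_exp l (c + d) = letter_exp l c * letter_exp l d.
Proof.
apply/funext => w; rewrite ncs_mulE /letter_exp.
case: ifP => [lw|/negbT lw]; last first.
  rewrite big1// => k _; move: lw; have := cat_take_drop k w.
  move=> /(congr1 (all (pred1 l))) <-; rewrite all_cat.
  by case: ifP; rewrite ?mul0r//; case: ifP; rewrite ?mulr0.
rewrite addrC exprDn mulr_suml; apply: eq_bigr => k _.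
have kw : (k <= size w)%N by rewrite -ltnS.
have := congr1 (all (pred1 l)) (cat_take_drop k w).
rewrite all_cat lw => /andP[-> ->].
rewrite size_takel// size_drop -(@bin_fact (size w) k)// natrM.
rewrite -mulr_natl.
have := pnatr_eq0 R[i] k`!; have := pnatr_eq0 R[i] (size w - k)`!.
have := pnatr_eq0 R[i] 'C(size w, k).
rewrite !eqn0Ngt !fact_gt0 bin_gt0 kw/= !natrM => /negbT h1 /negbT h2 /negbT h3.
by field; rewrite h1 h2 h3.
Qed.

Lemma letter_expN l c : letter_exp l (- c) * letter_exp l c = 1.
Proof. by rewrite -letter_expD addNr letter_exp0. Qed.

Lemma letter_exp_subst (s : L -> ncs R L) l l' c : (forall l, s l [::] = 0) ->
  s l = ncs_letter R l' -> ncs_subst s (letter_exp l c) = letter_exp l' c.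
Proof.
move=> s0 sl; rewrite -ncs_exp_letter ncs_subst_exp//; last first.
  by rewrite ncs_scaleE mulr0.
by rewrite ncs_substZ ncs_subst_letter// sl ncs_exp_letter.
Qed.

End LetterExp.

(** * Complex-valued functions of a real variable *)

Section ComplexParts.
Context (R : realType).
Implicit Types (x y : R[i]).
Lemma Re_add x y : complex.Re (x + y) = complex.Re x + complex.Re y.
Proof. by case: x y => [? ?] [? ?]. Qed.
Lemma Im_add x y : complex.Im (x + y) = complex.Im x + complex.Im y.
Proof. by case: x y => [? ?] [? ?]. Qed.
Lemma Re_opp x : complex.Re (- x) = - complex.Re x.
Proof. by case: x. Qed.
Lemma Im_opp x : complex.Im (- x) = - complex.Im x.
Proof. by case: x. Qed.
Lemma Re_mul x y :
  complex.Re (x * y) = complex.Re x * complex.Re y - complex.Im x * complex.Im y.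
Proof. by case: x y => [? ?] [? ?]. Qed.
Lemma Im_mul x y :
  complex.Im (x * y) = complex.Re x * complex.Im y + complex.Im x * complex.Re y.
Proof. by case: x y => [? ?] [? ?]. Qed.
Lemma Re_inv x : complex.Re x^-1 = complex.Re x / (complex.Re x ^+ 2 + complex.Im x ^+ 2).
Proof. by case: x. Qed.
Lemma Im_inv x : complex.Im x^-1 = - (complex.Im x / (complex.Re x ^+ 2 + complex.Im x ^+ 2)).
Proof. by case: x. Qed.
Lemma complex_ext x y : complex.Re x = complex.Re y -> complex.Im x = complex.Im y -> x = y.
Proof. by case: x y => [? ?] [? ?] /= -> ->. Qed.

Definition sqnorm x := complex.Re x ^+ 2 + complex.Im x ^+ 2.

Lemma normc_sqnorm x : Normc.normc x ^+ 2 = sqnorm x.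
Proof. by case: x => a b; rewrite /sqnorm/= sqr_sqrtr// addr_ge0// sqr_ge0. Qed.
Lemma sqnorm_eq0 x : (sqnorm x == 0) = (x == 0).
Proof. by rewrite /sqnorm paddr_eq0 ?sqr_ge0// !sqrf_eq0 eq_complex. Qed.
Lemma sqnormM x y : sqnorm (x * y) = sqnorm x * sqnorm y.
Proof. by rewrite /sqnorm Re_mul Im_mul; ring. Qed.
End ComplexParts.

Section ComplexDerivative.
Context (R : realType).
Implicit Types (f g : R -> R[i]) (t : R) (d e : R[i]).

(** Stated on real and imaginary parts so that [ncs_is_derive] is this notion at
    each word. *)
Definition cder g t d : Prop :=
  is_derive t 1 (fun x => complex.Re (g x)) (complex.Re d) /\
  is_derive t 1 (fun x => complex.Im (g x)) (complex.Im d).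

Lemma cder_eq g t d e : cder g t d -> d = e -> cder g t e.
Proof. by move=> ? <-. Qed.

Lemma cder_cst c t : cder (fun=> c) t 0.
Proof. by split; exact: is_derive_cst. Qed.

Lemma cderD f g t d e : cder f t d -> cder g t e ->
  cder (fun x => f x + g x) t (d + e).
Proof.
move=> [f1 f2] [g1 g2]; split.
  by under eq_fun do rewrite Re_add; rewrite Re_add; exact: is_deriveD.
by under eq_fun do rewrite Im_add; rewrite Im_add; exact: is_deriveD.
Qed.

Lemma cderN f t d : cder f t d -> cder (fun x => - f x) t (- d).
Proof.
move=> [f1 f2]; split.
  by under eq_fun do rewrite Re_opp; rewrite Re_opp; exact: is_deriveN.
by under eq_fun do rewrite Im_opp; rewrite Im_opp; exact: is_deriveN.
Qed.

Lemma cderM f g t d e : cder f t d -> cder g t e ->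
  cder (fun x => f x * g x) t (d * g t + f t * e).
Proof.
move=> [f1 f2] [g1 g2]; split.
  under eq_fun do rewrite Re_mul.
  apply: (is_derive_eq (is_deriveB (is_deriveM f1 g1) (is_deriveM f2 g2))).
  by rewrite /GRing.scale/= Re_add !Re_mul; ring.
under eq_fun do rewrite Im_mul.
apply: (is_derive_eq (is_deriveD (is_deriveM f1 g2) (is_deriveM f2 g1))).
by rewrite /GRing.scale/= Im_add !Im_mul; ring.
Qed.

Lemma cderZ c f t d : cder f t d -> cder (fun x => c * f x) t (c * d).
Proof.
by move=> fd; apply: (cder_eq (cderM (cder_cst c t) fd)); rewrite mul0r add0r.
Qed.

Lemma cder_sum (I : Type) (r : seq I) (P : pred I) (F : I -> R -> R[i])
    (D : I -> R[i]) t : (forall i, P i -> cder (F i) t (D i)) ->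
  cder (fun x => \sum_(i <- r | P i) F i x) t (\sum_(i <- r | P i) D i).
Proof.
move=> FD; elim: r => [|i r IH].
  by rewrite big_nil; under eq_fun do rewrite big_nil; exact: cder_cst.
rewrite big_cons; under eq_fun do rewrite big_cons.
by case: ifPn => // Pi; apply: cderD => //; exact: FD.
Qed.

Lemma cderX f t d n : cder f t d ->
  cder (fun x => f x ^+ n) t ((f t ^+ n.-1 *+ n) * d).
Proof.
move=> fd; elim: n => [|n IH].
  by rewrite mulr0n mul0r; under eq_fun do rewrite expr0; exact: cder_cst.
under eq_fun do rewrite exprS.
apply: (cder_eq (cderM fd IH)); rewrite mulrA mulrnAr.
by case: n {IH} => [|n]/=; rewrite -?exprS ?mulrS; ring.
Qed.

Lemma cderV f t d : f t != 0 -> cder f t d ->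
  cder (fun x => (f x)^-1) t (- (f t)^-2 * d).
Proof.
move=> ft0 [f1 f2].
have := ft0; rewrite -sqnorm_eq0 => n0.
have dn := is_deriveD (is_deriveM f1 f1) (is_deriveM f2 f2).
have dV := is_deriveV (f := fun x => complex.Re (f x) * complex.Re (f x) +
  complex.Im (f x) * complex.Im (f x)) _ dn.
have -> : (f t) ^- 2 = (f t)^-1 * (f t)^-1 by rewrite expr2 invfM.
rewrite /sqnorm in n0.
split.
  under eq_fun do rewrite Re_inv !expr2.
  apply: (is_derive_eq (is_deriveM f1 (dV _))); first by rewrite -!expr2.
  rewrite /GRing.scale/= !(Re_mul,Im_mul,Re_opp,Im_opp,Re_inv,Im_inv).
  by field; rewrite ?mulf_neq0 -?expr2.
under eq_fun do rewrite Im_inv !expr2.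
apply: (is_derive_eq (is_deriveN (is_deriveM f2 (dV _)))); first by rewrite -!expr2.
rewrite /GRing.scale/= !(Re_mul,Im_mul,Re_opp,Im_opp,Re_inv,Im_inv).
by field; rewrite ?mulf_neq0 -?expr2.
Qed.

(** The principal logarithm on the right half plane, written with [atan] so that
    it can be differentiated along paths. *)
Definition clog (z : R[i]) : R[i] :=
  (ln (sqnorm z) / 2) +i* atan (complex.Im z / complex.Re z).

Lemma cder_clog f t d : 0 < complex.Re (f t) -> cder f t d ->
  cder (fun x => clog (f x)) t ((f t)^-1 * d).
Proof.
move=> ft0 [f1 f2].
have n0 : 0 < sqnorm (f t) by rewrite ltr_pwDl ?sqr_ge0// exprn_gt0.
have dn := is_deriveD (is_deriveM f1 f1) (is_deriveM f2 f2).
split => /=.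
  rewrite /sqnorm; under eq_fun do rewrite !expr2 [_ / 2]mulrC.
  have n0' : 0 < (complex.Re (f t) * complex.Re (f t) + complex.Im (f t) * complex.Im (f t)).
    by rewrite -!expr2.
  have dl := is_derive1_comp (g := fun x => complex.Re (f x) * complex.Re (f x)
    + complex.Im (f x) * complex.Im (f x)) (is_derive1_ln n0') dn.
  apply: (is_derive_eq (is_deriveZ (2^-1 : R) dl)).
  rewrite /GRing.scale/= !(Re_mul,Im_mul,Re_opp,Im_opp,Re_inv,Im_inv).
  by field; rewrite -?expr2 lt0r_neq0.
have dV := is_deriveV (lt0r_neq0 ft0) f1.
apply: (is_derive_eq (is_derive1_comp (is_derive1_atan _) (is_deriveM f2 dV))).
rewrite /GRing.scale/= !(Re_mul,Im_mul,Re_opp,Im_opp,Re_inv,Im_inv).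
rewrite [X in 1 + X ^+ 2](_ : _ = complex.Im (f t) / complex.Re (f t))//.
field; rewrite !lt0r_neq0//= addrC; exact: n0.
Qed.

Lemma cder_is_constant g a b : (forall t, a < t < b -> cder g t 0) ->
  forall x y, a < x < b -> a < y < b -> g x = g y.
Proof.
move=> g0.
have cst (h : R -> R) : (forall t, a < t < b -> is_derive t 1 h 0) ->
    forall x y, a < x < b -> a < y < b -> x <= y -> h x = h y.
  move=> h0 x y /andP[ax xb] /andP[ay yb] xy.
  have dh z : z \in `[x, y] -> is_derive z 1 h 0.
    rewrite in_itv/= => /andP[xz zy]; apply: h0.
    by rewrite (lt_le_trans ax xz) (le_lt_trans zy yb).
  have dh' z : z \in `]x, y[ -> is_derive z 1 h ((fun=> 0) z).
    by move=> zxy; apply: dh; exact: subset_itv_oo_cc.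
  have [|c _] := MVT_segment xy dh'.
    by apply: derivable_within_continuous => z /dh[].
  by rewrite mul0r => /eqP; rewrite subr_eq0 => /eqP.
have cst2 (h : R -> R) : (forall t, a < t < b -> is_derive t 1 h 0) ->
    forall x y, a < x < b -> a < y < b -> h x = h y.
  move=> h0 x y hx hy; have [xy|/ltW yx] := leP x y; first exact: cst.
  by rewrite (cst h h0 y x).
move=> x y hx hy; apply: complex_ext.
  by apply: (cst2 (fun t => complex.Re (g t))) => // t /g0[].
by apply: (cst2 (fun t => complex.Im (g t))) => // t /g0[].
Qed.

End ComplexDerivative.

Section ComplexLimit.
Context (R : realType) (T : Type) (F : set_system T) {FF : Filter F}.
Implicit Types (f g : T -> R[i]) (l m : R[i]).

Definition ccvg f l : Prop :=
  complex.Re (f x) @[x --> F] --> complex.Re l /\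
  complex.Im (f x) @[x --> F] --> complex.Im l.

Lemma ccvg_cst l : ccvg (fun=> l) l.
Proof. by split; exact: cvg_cst. Qed.

Lemma ccvgD f g l m : ccvg f l -> ccvg g m -> ccvg (fun x => f x + g x) (l + m).
Proof.
move=> [f1 f2] [g1 g2]; split.
  by under eq_fun do rewrite Re_add; rewrite Re_add; exact: cvgD.
by under eq_fun do rewrite Im_add; rewrite Im_add; exact: cvgD.
Qed.

Lemma ccvgM f g l m : ccvg f l -> ccvg g m -> ccvg (fun x => f x * g x) (l * m).
Proof.
move=> [f1 f2] [g1 g2]; split.
  under eq_fun do rewrite Re_mul; rewrite Re_mul.
  by apply: cvgB; exact: cvgM.
under eq_fun do rewrite Im_mul; rewrite Im_mul.
by apply: cvgD; exact: cvgM.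
Qed.

Lemma ccvg_sum (I : Type) (r : seq I) (P : pred I) (f : I -> T -> R[i])
    (l : I -> R[i]) : (forall i, P i -> ccvg (f i) (l i)) ->
  ccvg (fun x => \sum_(i <- r | P i) f i x) (\sum_(i <- r | P i) l i).
Proof.
move=> fl; elim: r => [|i r IH].
  by rewrite big_nil; under eq_fun do rewrite big_nil; exact: ccvg_cst.
rewrite big_cons; under eq_fun do rewrite big_cons.
by case: ifPn => // Pi; apply: ccvgD => //; exact: fl.
Qed.

Lemma ccvgX f l n : ccvg f l -> ccvg (fun x => f x ^+ n) (l ^+ n).
Proof.
move=> fl; elim: n => [|n IH]; first exact: ccvg_cst.
by rewrite exprS; under eq_fun do rewrite exprS; exact: ccvgM.
Qed.

Lemma ccvg_unique {PF : ProperFilter F} f l m : ccvg f l -> ccvg f m -> l = m.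
Proof.
move=> [f1 f2] [g1 g2]; apply: complex_ext.
  exact: (cvg_unique _ f1 g1).
exact: (cvg_unique _ f2 g2).
Qed.

Lemma ccvg_near f g l : (\forall x \near F, f x = g x) -> ccvg f l -> ccvg g l.
Proof.
move=> fg [f1 f2]; split.
  apply: cvg_trans f1; apply: near_eq_cvg; near=> x.
  by congr complex.Re; near: x.
apply: cvg_trans f2; apply: near_eq_cvg; near=> x.
by congr complex.Im; near: x.
Unshelve. all: by end_near. Qed.

End ComplexLimit.

(** * Power series with bounded coefficients *)

Section Norm.
Context (R : realType).
Implicit Types (x y : R[i]).
Lemma normc_ge0 x : 0 <= normc x. Proof. by case: x => a b; exact: sqrtr_ge0. Qed.
Lemma normcX x n : normc (x ^+ n) = normc x ^+ n.
Proof. by elim: n => [|n IH]; rewrite ?normc1// !exprS normcM IH. Qed.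
Lemma abs_Re_le x : `|complex.Re x| <= normc x.
Proof. by case: x => a b /=; rewrite -sqrtr_sqr ler_sqrt ?addr_ge0 ?sqr_ge0// lerDl sqr_ge0. Qed.
Lemma abs_Im_le x : `|complex.Im x| <= normc x.
Proof. by case: x => a b /=; rewrite -sqrtr_sqr ler_sqrt ?addr_ge0 ?sqr_ge0// lerDr sqr_ge0. Qed.
Lemma normcD x y : normc (x + y) <= normc x + normc y.
Proof. exact: le_normcD. Qed.
Lemma normcNE x : normc (- x) = normc x.
Proof. by case: x => a b /=; rewrite !sqrrN. Qed.
Lemma normcC (a : R) : 0 <= a -> normc a%:C = a.
Proof. by move=> a0; rewrite /= expr0n addr0 sqrtr_sqr ger0_norm. Qed.
Lemma normc_sum N (F : nat -> R[i]) :
  normc (\sum_(n < N) F n) <= \sum_(n < N) normc (F n).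
Proof.
elim: N => [|N IH]; first by rewrite !big_ord0 normc0.
by rewrite !big_ord_recr/= (le_trans (normcD _ _))// lerD2r.
Qed.
End Norm.

Section DerivativeRemainder.
Context (R : realType).

(** A remainder dominated by a multiple of a function that vanishes to second
    order has derivative zero. *)
Lemma is_derive_small (e q : R -> R) (t M : R) :
  is_derive t 1 q 0 -> q t = 0 -> (\forall x \near t, `|e x| <= M * q x) ->
  is_derive t 1 e 0.
Proof.
move=> [dq q0] qt0 eq.
have et0 : e t = 0.
  by have := nbhs_singleton eq; rewrite qt0 mulr0 normr_le0 => /eqP.
have shiftt : (h *: (1 : R) + t) @[h --> (0 : R)^'] --> t.
  have : (h *: (1 : R) + t) @[h --> (0 : R)] --> (0 : R) *: (1 : R) + t.
    by apply: cvgD; [apply: cvgZr_tmp; exact: cvg_id | exact: cvg_cst].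
  rewrite scale0r add0r => c; apply: cvg_trans c; apply: cvg_app.
  exact: cvg_within.
have cq : (h^-1 *: ((q \o shift t) (h *: (1 : R)) - q t)) @[h --> (0 : R)^'] --> (0 : R).
  by rewrite -[X in _ --> X]q0; exact: dq.
have ce : (h^-1 *: ((e \o shift t) (h *: (1 : R)) - e t)) @[h --> (0 : R)^'] --> (0 : R).
  apply/norm_cvg0P.
  have cM : (`|M| * `|h^-1 *: ((q \o shift t) (h *: (1 : R)) - q t)|) @[h --> (0 : R)^'] --> (0 : R).
    rewrite -[X in _ --> X](mulr0 `|M|); apply: cvgM; first exact: cvg_cst.
    by rewrite -[X in _ --> X](normr0 R); exact: cvg_norm.
  apply: (squeeze_cvgr _ (cvg_cst 0) cM).
  have near_eq : \forall h \near (0 : R)^', `|e (h *: (1 : R) + t)| <= M * q (h *: (1 : R) + t) by exact: (shiftt _ eq).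
  apply: filterS near_eq => h /= eh.
  rewrite normr_ge0/= qt0 et0 !subr0 !normrM mulrCA ler_wpM2l//.
  by rewrite (le_trans eh)// -normrM ler_norm.
apply: DeriveDef; first by apply/cvg_ex; exists 0.
exact: cvg_lim ce.
Qed.

(** Chain rule for a complex function along a real path. A quadratic bound on
    the Taylor remainder replaces complex differentiability; for power series it
    is available as a bound uniform in the partial sums. *)
Lemma cder_comp_quad (P : R[i] -> R[i]) (g : R -> R[i]) t (g' d : R[i]) (rho K : R) :
  0 < rho -> cder g t g' ->
  (forall h, normc h <= rho ->
    normc (P (g t + h) - P (g t) - d * h) <= K * normc h ^+ 2) ->
  cder (fun x => P (g x)) t (d * g').
Proof.
move=> rho0 gg' HP.
pose q x := sqnorm (g x - g t).
pose e x := P (g x) - P (g t) - d * (g x - g t).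
have dgt : cder (fun x => g x - g t) t g'.
  by apply: (cder_eq (cderD gg' (cder_cst (- g t) t))); rewrite addr0.
have qt : q t = 0 by apply/eqP; rewrite sqnorm_eq0 subrr.
have dq : is_derive t 1 q 0.
  have [g1 g2] := dgt.
  rewrite /q /sqnorm; under eq_fun do rewrite !expr2.
  apply: (is_derive_eq (is_deriveD (is_deriveM g1 g1) (is_deriveM g2 g2))).
  by rewrite !subrr !scale0r !addr0.
have eq : \forall x \near t, normc (e x) <= K * q x.
  have cq : q x @[x --> t] --> (0 : R).
    rewrite -qt; apply: differentiable_continuous.
    by apply/derivable1_diffP; case: dq.
  have rho2 : 0 < rho ^+ 2 by rewrite exprn_gt0.
  have qn : \forall x \near t, q x < rho ^+ 2 by exact: (cvgr_lt _ cq).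
  apply: filterS qn => x qx.
  have nx : normc (g x - g t) <= rho.
    rewrite -(@ler_pXn2r _ 2) ?nnegrE ?normc_ge0 ?(ltW rho0)//.
    by rewrite normc_sqnorm ltW.
  have := HP _ nx; rewrite (addrC (g t)) subrK normc_sqnorm; exact.
have de : cder e t 0.
  split.
    apply: (is_derive_small dq qt); apply: filterS eq => x.
    exact: le_trans (abs_Re_le _).
  apply: (is_derive_small dq qt); apply: filterS eq => x.
  exact: le_trans (abs_Im_le _).
have -> : (fun x => P (g x)) = (fun x => (e x + P (g t)) + d * (g x - g t)).
  by apply/funext => x; rewrite /e; ring.
apply: (cder_eq (cderD (cderD de (cder_cst _ _)) (cderZ d dgt))).
by rewrite !add0r.
Qed.
End DerivativeRemainder.

Section PowerSeries.
Context (R : realType).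
Implicit Types (a : nat -> R[i]) (z h : R[i]) (r : R).

Definition psum a z N : R[i] := \sum_(n < N) a n * z ^+ n.
Definition dpsum a z N : R[i] := \sum_(n < N) a n * (z ^+ n.-1 *+ n).
Definition pval a z : R[i] :=
  limn (fun N => complex.Re (psum a z N)) +i*
  limn (fun N => complex.Im (psum a z N)).
Definition bdd a := exists B, forall n, normc (a n) <= B.

Lemma bdd_ge0 a : bdd a -> exists2 B, 0 <= B & forall n, normc (a n) <= B.
Proof. by move=> [B aB]; exists B => //; exact: le_trans (normc_ge0 _) (aB 0). Qed.

Lemma pval_cvg a z : bdd a -> normc z < 1 -> ccvg \oo (psum a z) (pval a z).
Proof.
move=> [B aB] z1.
have B0 : 0 <= B := le_trans (normc_ge0 _) (aB 0).
have cv (u : nat -> R) : (forall n, `|u n| <= normc (a n * z ^+ n)) -> cvgn (series u).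
  move=> un; apply: normed_cvg.
  apply: (@series_le_cvg _ _ (geometric B (normc z))) => // n.
  - exact: normr_ge0.
  - by apply: mulr_ge0 => //; rewrite exprn_ge0// normc_ge0.
  - by rewrite /= (le_trans (un n))// normcM normcX ler_wpM2r// exprn_ge0// normc_ge0.
  by apply: is_cvg_geometric_series; rewrite ger0_norm// normc_ge0.
have ReS N : complex.Re (psum a z N) = series (fun n => complex.Re (a n * z ^+ n)) N.
  rewrite /series/= big_mkord /psum; elim: N => [|N IH]; rewrite ?big_ord0//.
  by rewrite !big_ord_recr/= Re_add IH.
have ImS N : complex.Im (psum a z N) = series (fun n => complex.Im (a n * z ^+ n)) N.
  rewrite /series/= big_mkord /psum; elim: N => [|N IH]; rewrite ?big_ord0//.
  by rewrite !big_ord_recr/= Im_add IH.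
split => /=.
  by under eq_fun do rewrite ReS; apply: cv => n; exact: abs_Re_le.
by under eq_fun do rewrite ImS; apply: cv => n; exact: abs_Im_le.
Qed.

(** Summing x_(n+1) = r x_n + y_n gives (1 - r) (sum of x) <= x_0 + (sum of y).
    Applied successively to r^n, n r^(n-1) and [dpow2 r], this bounds all the
    series that control the differentiation of a power series. *)
Lemma affine_rec_sum r (x y : nat -> R) M : 0 <= r -> r < 1 ->
  (forall n, 0 <= x n) -> (forall n, x n.+1 = r * x n + y n) ->
  (forall N, \sum_(n < N) y n <= M) ->
  forall N, \sum_(n < N) x n <= (x 0%N + M) / (1 - r).
Proof.
move=> r0 r1 x0 xS yM N; rewrite ler_pdivlMr ?subr_gt0//.
have : \sum_(n < N) x n <= \sum_(n < N.+1) x n by rewrite big_ord_recr lerDl.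
have E : \sum_(n < N) x n.+1 = \sum_(n < N) (r * x n + y n).
  by apply: eq_bigr => n _; exact: xS.
rewrite big_ord_recl/= [X in _ + X]E big_split/= -mulr_sumr; have := yM N.
move: (\sum_(n < N) x n) (\sum_(n < N) y n) => X Y.
move=> h1 h2; rewrite mulrBr mulr1 (mulrC X); move: (r * X) h2 => Z h2; lra.
Qed.

Definition dpow r n := r ^+ n.-1 *+ n.

(** The recursion followed by the Taylor remainder of z^n at order two, see
    [pow_remainder]; it is n (n - 1) / 2 r^(n - 2). *)
Fixpoint dpow2 r n := if n is m.+1 then r * dpow2 r m + dpow r m else 0.

Lemma dpow_ge0 r n : 0 <= r -> 0 <= dpow r n.
Proof. by move=> r0; rewrite mulrn_wge0// exprn_ge0. Qed.
Lemma dpow2_ge0 r n : 0 <= r -> 0 <= dpow2 r n.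
Proof. by move=> r0; elim: n => //= n IH; rewrite addr_ge0 ?mulr_ge0 ?dpow_ge0. Qed.
Lemma dpowS r n : dpow r n.+1 = r * dpow r n + r ^+ n.
Proof. by rewrite /dpow/= mulrS addrC; case: n => [|n]; rewrite ?mulr0// mulrnAr -exprS. Qed.

Lemma sum_dpow_bound r : 0 <= r -> r < 1 -> forall N, \sum_(n < N) dpow r n <= (1 - r)^-1 / (1 - r).
Proof.
move=> r0 r1 N.
have h N' : \sum_(n < N') r ^+ n <= (1 - r)^-1.
  have := @affine_rec_sum r (fun n => r ^+ n) (fun=> 0) 0 r0 r1 _ _ _ N'.
  rewrite expr0 addr0 mul1r; apply => [n|n|N''].
  - by rewrite exprn_ge0.
  - by rewrite exprS addr0.
  - by rewrite big1.
have := @affine_rec_sum r (dpow r) _ _ r0 r1 (fun n => dpow_ge0 n r0) (dpowS r) h N.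
by rewrite /dpow/= mulr0n add0r.
Qed.

Lemma sum_dpow2_bound r : 0 <= r -> r < 1 ->
  exists2 M, 0 <= M & forall N, \sum_(n < N) dpow2 r n <= M.
Proof.
move=> r0 r1; exists ((dpow2 r 0 + (1 - r)^-1 / (1 - r)) / (1 - r)).
  by rewrite /= add0r !mulr_ge0// invr_ge0 subr_ge0 ltW.
apply: affine_rec_sum => //; first by move=> n; exact: dpow2_ge0.
exact: sum_dpow_bound.
Qed.

Lemma dpow_cvg0 r : 0 <= r -> r < 1 -> dpow r n @[n --> \oo] --> (0 : R).
Proof.
move=> r0 r1; apply: cvg_series_cvg_0; apply: nondecreasing_is_cvgn.
  by apply: nondecreasing_series => n _ _; exact: dpow_ge0.
exists ((1 - r)^-1 / (1 - r)) => _ [N _ <-].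
by rewrite /series/= big_mkord; exact: sum_dpow_bound.
Qed.

Lemma pow_remainder z h r n : normc z <= r -> normc (z + h) <= r ->
  normc ((z + h) ^+ n - z ^+ n - (z ^+ n.-1 *+ n) * h) <= dpow2 r n * normc h ^+ 2.
Proof.
move=> zr zhr; have r0 : 0 <= r := le_trans (normc_ge0 _) zr.
elim: n => [|n IH].
  by rewrite !expr0 mulr0n mul0r subr0 subrr normc0 mul0r.
have -> : (z + h) ^+ n.+1 - z ^+ n.+1 - (z ^+ n.+1.-1 *+ n.+1) * h =
   (z + h) * ((z + h) ^+ n - z ^+ n - (z ^+ n.-1 *+ n) * h) +
   (z ^+ n.-1 *+ n) * h ^+ 2.
  have -> : z ^+ n.+1.-1 *+ n.+1 = z * (z ^+ n.-1 *+ n) + z ^+ n.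
    by rewrite /= mulrS addrC; case: n {IH} => [|n]; rewrite ?mulr0// mulrnAr -exprS.
  by rewrite !exprS; ring.
rewrite (le_trans (normcD _ _))//= [X in _ <= X]mulrDl lerD//.
  rewrite normcM -mulrA ler_pM ?normc_ge0//.
rewrite normcM normcX ler_wpM2r ?exprn_ge0 ?normc_ge0//.
rewrite /dpow -mulr_natr normcM normcX -(mulr_natr (r ^+ _)).
have -> : n%:R = (n%:R : R)%:C :> R[i] by rewrite rmorph_nat.
rewrite normcC//.
by rewrite ler_wpM2r// lerXn2r ?nnegrE ?normc_ge0.
Qed.

Lemma ccvg_normc_le (c : nat -> R[i]) l (K : R) : ccvg \oo c l ->
  (forall n, normc (c n) <= K) -> normc l <= K.
Proof.
move=> [c1 c2] cK; have K0 : 0 <= K := le_trans (normc_ge0 _) (cK 0).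
rewrite -(@ler_pXn2r _ 2) ?nnegrE ?normc_ge0// normc_sqnorm.
have cs : sqnorm (c n) @[n --> \oo] --> sqnorm l.
  by rewrite /sqnorm; under eq_fun do rewrite !expr2; rewrite !expr2; apply: cvgD; apply: cvgM.
apply: (cvgr_to_le cs); apply: nearW => n.
by rewrite -normc_sqnorm ler_pXn2r ?nnegrE ?normc_ge0.
Qed.

(** The derivative is given as a limit of [dpsum]: the coefficients n a_n need
    not be bounded, and in the cases of interest the limit is known in closed
    form from the equation satisfied by the series. *)
Lemma cder_pval a (g : R -> R[i]) t (g' d : R[i]) : bdd a ->
  normc (g t) < 1 -> cder g t g' -> ccvg \oo (dpsum a (g t)) d ->
  cder (fun x => pval a (g x)) t (d * g').
Proof.
move=> abd z1 gg' cd; have [B B0 aB] := bdd_ge0 abd.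
pose rho := (1 - normc (g t)) / 2.
have rho0 : 0 < rho by rewrite divr_gt0// subr_gt0.
pose r := normc (g t) + rho.
have r0 : 0 <= r by rewrite addr_ge0 ?normc_ge0// ltW.
have r1 : r < 1 by rewrite /r /rho; lra.
have [M M0 hM] := sum_dpow2_bound r0 r1.
apply: (cder_comp_quad (rho := rho) (K := B * M)) => // h hrho.
have zr : normc (g t) <= r by rewrite lerDl ltW.
have zhr : normc (g t + h) <= r by rewrite (le_trans (normcD _ _))// lerD2l.
apply: (@ccvg_normc_le (fun N => psum a (g t + h) N - psum a (g t) N - dpsum a (g t) N * h)).
  have cN u v : ccvg \oo u v -> ccvg \oo (fun N => - u N) (- v).
    move=> uv; rewrite -mulN1r; under eq_fun do rewrite -mulN1r.
    by apply: ccvgM => //; exact: ccvg_cst.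
  apply: ccvgD; first apply: ccvgD.
  - by apply: pval_cvg => //; exact: le_lt_trans zhr r1.
  - by apply: cN; exact: pval_cvg.
  by apply: cN; apply: ccvgM => //; exact: ccvg_cst.
move=> N; rewrite /psum /dpsum mulr_suml -!sumrN -!big_split/=.
rewrite (le_trans (normc_sum N (fun n => a n * (g t + h) ^+ n - a n * g t ^+ n - a n * (g t ^+ n.-1 *+ n) * h)))//.
rewrite -mulrA (le_trans (y := \sum_(n < N) B * (dpow2 r n * normc h ^+ 2)))//.
  apply: ler_sum => n _.
  have -> : a n * (g t + h) ^+ n - a n * g t ^+ n - a n * (g t ^+ n.-1 *+ n) * h =
     a n * ((g t + h) ^+ n - g t ^+ n - (g t ^+ n.-1 *+ n) * h) by ring.
  by rewrite normcM ler_pM ?normc_ge0// pow_remainder.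
rewrite -mulr_sumr -mulr_suml ler_wpM2l// ler_wpM2r//.
by rewrite exprn_ge0// normc_ge0.
Qed.

End PowerSeries.

(** * Primitives of a(z) / z and a(z) / (z - zeta) *)

Section Primitives.
Context (R : realType).
Implicit Types (a : nat -> R[i]) (z zeta : R[i]).

(** Coefficients of the primitive of (a(z) - a_0) / z; the entry at 0 is a
    division by zero, hence 0. *)
Definition int0 a n : R[i] := a n / n%:R.

(** If b is the primitive of a(z) / (z - zeta), then c_n = n b_n satisfies
    c_n - zeta c_(n+1) = a_n, which is the equation (z - zeta) b' = a. *)
Fixpoint pole_coef zeta a n : R[i] :=
  if n is m.+1 then (pole_coef zeta a m - a m) / zeta else 0.
Definition int_pole zeta a n : R[i] := pole_coef zeta a n / n%:R.

Lemma normc_nat n : normc (n%:R : R[i]) = n%:R.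
Proof.
have -> : n%:R = (n%:R : R)%:C :> R[i] by rewrite rmorph_nat.
by rewrite normcC.
Qed.

Lemma bdd_int0 a : bdd a -> bdd (int0 a).
Proof.
move=> /bdd_ge0[B B0 aB]; exists B => n.
rewrite normcM normcV normc_nat; case: n => [|n]; first by rewrite invr0 mulr0.
rewrite ler_pdivrMr ?ltr0Sn// (le_trans (aB _))// ler_peMr// ler1n//.
Qed.

(** A pole on the unit circle makes c_n grow at most linearly, so dividing by n
    keeps the coefficients bounded: iterated primitives never leave the class of
    bounded sequences. *)
Lemma pole_coef_bound zeta a B n : normc zeta = 1 ->
  (forall n, normc (a n) <= B) -> normc (pole_coef zeta a n) <= n%:R * B.
Proof.
move=> z1 aB; elim: n => [|n IH]; first by rewrite normc0 mul0r.
rewrite /= normcM normcV z1 invr1 mulr1 (le_trans (normcD _ _))// normcNE.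
by rewrite -natr1 mulrDl mul1r lerD.
Qed.

Lemma bdd_int_pole zeta a : normc zeta = 1 -> bdd a -> bdd (int_pole zeta a).
Proof.
move=> z1 /bdd_ge0[B B0 aB]; exists B => n.
rewrite normcM normcV normc_nat; case: n => [|n]; first by rewrite invr0 mulr0.
rewrite ler_pdivrMr ?ltr0Sn// mulrC; exact: pole_coef_bound.
Qed.

Lemma bddB a b : bdd a -> bdd b -> bdd (fun n => a n - b n).
Proof.
move=> [A aA] [B bB]; exists (A + B) => n.
by rewrite (le_trans (normcD _ _))// normcNE lerD.
Qed.

Lemma ccvg_shiftS (u : nat -> R[i]) l : ccvg \oo (fun n => u n.+1) l -> ccvg \oo u l.
Proof.
move=> [h1 h2]; split.
  by have := h1; rewrite (cvg_shiftS (fun n => complex.Re (u n))).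
by have := h2; rewrite (cvg_shiftS (fun n => complex.Im (u n))).
Qed.

Lemma ccvg0_normc (u : nat -> R[i]) (v : nat -> R) :
  (forall n, normc (u n) <= v n) -> v n @[n --> \oo] --> (0 : R) -> ccvg \oo u 0.
Proof.
move=> uv v0; split => /=; apply/norm_cvg0P;
  apply: (squeeze_cvgr _ (cvg_cst 0) v0); apply: nearW => n;
  rewrite normr_ge0/= (le_trans _ (uv n))//; [exact: abs_Re_le|exact: abs_Im_le].
Qed.

Lemma natSr_neq0 n : n.+1%:R != 0 :> R[i].
Proof. by rewrite pnatr_eq0. Qed.

Lemma dpsum_int0 a z N : z != 0 ->
  dpsum (int0 a) z N.+1 = z^-1 * (psum a z N.+1 - a 0%N).
Proof.
move=> z0; rewrite /dpsum /psum; elim: N => [|N IH].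
  by rewrite !big_ord1 mulr0n mulr0 expr0 mulr1 subrr mulr0.
rewrite big_ord_recr [in RHS]big_ord_recr/= IH /int0 exprS.
have n0 := natSr_neq0 N; rewrite -(mulr_natr (z ^+ N)).
by field; rewrite z0 addrC natr1.
Qed.

(** The product of (z - zeta) with the partial sum telescopes, leaving a
    boundary term that tends to 0 in the unit disc. *)
Lemma dpsum_int_pole zeta a z N : zeta != 0 -> z != zeta ->
  dpsum (int_pole zeta a) z N.+1 =
    (z - zeta)^-1 * (psum a z N + pole_coef zeta a N * z ^+ N).
Proof.
move=> zeta0 zz; rewrite /dpsum /psum; elim: N => [|N IH].
  by rewrite big_ord1 big_ord0 mulr0n mul0r addr0 !mulr0.
rewrite big_ord_recr [in RHS]big_ord_recr/= IH /int_pole/= !exprS.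
have n0 := natSr_neq0 N; rewrite -(mulr_natr (z ^+ N)).
by field; rewrite subr_eq0 zz zeta0 addrC natr1.
Qed.

Lemma dpsum_at0 a : ccvg \oo (dpsum a 0) (a 1%N).
Proof.
apply: ccvg_shiftS; apply: ccvg_shiftS.
have -> : (fun n => dpsum a 0 n.+2) = fun=> a 1%N; last exact: ccvg_cst.
apply/funext => n; rewrite /dpsum 2!big_ord_recl big1/= => [|k _].
  by rewrite mulr0n mulr0 add0r addr0 expr0 mulr1.
by rewrite expr0n mul0rn mulr0.
Qed.

Lemma pval_at0 a : pval a 0 = a 0%N.
Proof.
have E n : psum a 0 n.+1 = a 0%N.
  rewrite /psum big_ord_recl big1/= => [|k _]; last by rewrite expr0n mulr0.
  by rewrite expr0 mulr1 addr0.
have cv : ccvg \oo (psum a 0) (a 0%N).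
  by apply: ccvg_shiftS; under eq_fun do rewrite E; exact: ccvg_cst.
case: cv => c1 c2; apply: complex_ext; rewrite /pval/=.
  exact: cvg_lim c1.
exact: cvg_lim c2.
Qed.

Lemma dpsum_int0_cvg a z : bdd a -> normc z < 1 -> z != 0 ->
  ccvg \oo (dpsum (int0 a) z) (z^-1 * (pval a z - a 0%N)).
Proof.
move=> abd z1 z0; apply: ccvg_shiftS.
under eq_fun do rewrite dpsum_int0//.
apply: ccvgM; first exact: ccvg_cst.
apply: ccvgD; last exact: ccvg_cst.
have [h1 h2] := pval_cvg abd z1; split.
  by have := h1; rewrite -(cvg_shiftS (fun n => complex.Re (psum a z n))).
by have := h2; rewrite -(cvg_shiftS (fun n => complex.Im (psum a z n))).
Qed.

Lemma dpsum_int_pole_cvg zeta a z : normc zeta = 1 -> bdd a -> normc z < 1 ->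
  ccvg \oo (dpsum (int_pole zeta a) z) ((z - zeta)^-1 * pval a z).
Proof.
move=> zeta1 abd z1; apply: ccvg_shiftS.
have zeta0 : zeta != 0.
  by apply/eqP => h; move/eqP: zeta1; rewrite h normc0 eq_sym oner_eq0.
have zz : z != zeta by apply/eqP => h; move: z1; rewrite h zeta1 ltxx.
under eq_fun do rewrite dpsum_int_pole//.
apply: ccvgM; first exact: ccvg_cst.
rewrite -[pval a z]addr0; apply: ccvgD; first exact: pval_cvg.
have [B B0 aB] := bdd_ge0 abd.
apply: (@ccvg0_normc _ (fun n => B * normc z * dpow (normc z) n)).
  move=> n; rewrite normcM normcX /dpow.
  apply: (le_trans (ler_wpM2r _ (pole_coef_bound n zeta1 aB))).
    by rewrite exprn_ge0// normc_ge0.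
  rewrite -mulr_natl; case: n => [|n]; first by rewrite !mul0r !mulr0.
  by rewrite /= exprS le_eqVlt; apply/orP; left; apply/eqP; ring.
rewrite -[X in _ --> X](mulr0 (B * normc z)); apply: cvgM; first exact: cvg_cst.
exact: dpow_cvg0 (normc_ge0 _) z1.
Qed.

End Primitives.

(** * Linear differential equations on series *)

Section SeriesCalculus.
Context (R : realType) (L : finType).
Implicit Types (H K D E : R -> ncs R L) (f g h c r : ncs R L) (w : seq L) (t : R).

Lemma ncs_derive_eq H t f g : ncs_is_derive H t f -> f = g -> ncs_is_derive H t g.
Proof. by move=> ? <-. Qed.

Lemma ncs_derive_coef H t f w : ncs_is_derive H t f -> cder (fun x => H x w) t (f w).
Proof. by move=> /(_ w). Qed.

Lemma ncs_deriveM H K t f g : ncs_is_derive H t f -> ncs_is_derive K t g ->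
  ncs_is_derive (fun x => H x * K x) t (f * K t + H t * g).
Proof.
move=> Hf Kg w.
suff : cder (fun x => (H x * K x) w) t ((f * K t + H t * g) w) by [].
under eq_fun do rewrite ncs_mulE.
rewrite ncs_addE !ncs_mulE -big_split/=; apply: cder_sum => k _.
apply: cderM; exact: ncs_derive_coef.
Qed.

Lemma ncs_derive_cst c t : ncs_is_derive (fun=> c) t 0.
Proof. by move=> w; exact: (cder_cst (c w) t). Qed.

Lemma ncs_deriveMr H c t f : ncs_is_derive H t f ->
  ncs_is_derive (fun x => H x * c) t (f * c).
Proof.
move=> Hf; apply: (ncs_derive_eq (ncs_deriveM Hf (ncs_derive_cst c t))).
by rewrite mulr0 addr0.
Qed.

Lemma ncs_deriveB H K t f g : ncs_is_derive H t f -> ncs_is_derive K t g ->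
  ncs_is_derive (fun x => H x - K x) t (f - g).
Proof.
move=> Hf Kg w.
exact: (cderD (ncs_derive_coef w Hf) (cderN (ncs_derive_coef w Kg))).
Qed.

Lemma ncs_derive_subst (s : L -> ncs R L) H t f : ncs_is_derive H t f ->
  ncs_is_derive (fun x => ncs_subst s (H x)) t (ncs_subst s f).
Proof.
move=> Hf w.
apply: (@cder_sum _ _ _ xpredT (fun n : 'I_(size w).+1 => fun x =>
  \sum_(u : n.-tuple L) H x u * (\prod_(l <- u) s l) w)) => n _.
apply: cder_sum => u _; apply: (cder_eq (cderM (ncs_derive_coef u Hf) (cder_cst _ t))).
by rewrite mulr0 addr0.
Qed.

Lemma ncs_cvg_subst (s : L -> ncs R L) (F : set_system R) {FF : Filter F} H f :
  ncs_cvg H F f -> ncs_cvg (fun x => ncs_subst s (H x)) F (ncs_subst s f).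
Proof.
move=> Hf w.
apply: (@ccvg_sum _ _ F FF _ _ xpredT (fun n : 'I_(size w).+1 => fun x =>
  \sum_(u : n.-tuple L) H x u * (\prod_(l <- u) s l) w)) => n _.
by apply: ccvg_sum => u _; apply: ccvgM; [exact: Hf|exact: ccvg_cst].
Qed.

Lemma ncs_cvgM (F : set_system R) {FF : Filter F} H K f g :
  ncs_cvg H F f -> ncs_cvg K F g -> ncs_cvg (fun x => H x * K x) F (f * g).
Proof.
move=> Hf Kg w.
apply: (@ccvg_sum _ _ F FF _ _ xpredT (fun k : 'I_(size w).+1 => fun x =>
  H x (take k w) * K x (drop k w))) => k _.
by apply: ccvgM; [exact: Hf|exact: Kg].
Qed.

Lemma ncs_derive_cvg H t f : ncs_is_derive H t f -> ncs_cvg H (nbhs t) (H t).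
Proof.
have ct (h : R -> R) (d : R) : is_derive t 1 h d -> h x @[x --> t] --> h t.
  by move=> [dh _]; apply: differentiable_continuous; apply/derivable1_diffP.
by move=> Hf w; have [h1 h2] := Hf w; split; [exact: ct h1|exact: ct h2].
Qed.

(** When [Om] has no constant term, the equation is triangular for the length of
    words: once the shorter coefficients vanish, the next ones have derivative
    zero. *)
Lemma ode_unique_zero (Om D : R -> ncs R L) a b t0 :
  (forall t, Om t [::] = 0) ->
  (forall t, a < t < b -> ncs_is_derive D t (Om t * D t)) ->
  a < t0 < b -> D t0 = 0 -> forall t, a < t < b -> D t = 0.
Proof.
move=> Om0 HD ht0 D0 t ht; apply/funext => w.
have [n] := ubnP (size w); elim: n w t ht => // n IH w t ht wn.
have -> : (0 : ncs R L) w = D t0 w by rewrite D0.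
apply: (@cder_is_constant _ (fun x => D x w) a b) => // x hx.
apply: (cder_eq (ncs_derive_coef w (HD x hx))).
rewrite (@ncs_mul_local _ _ _ _ 0) ?mulr0// => v vw.
by apply: IH => //; rewrite (leq_trans vw).
Qed.

Lemma ode_unique (Om H K : R -> ncs R L) a b t0 :
  (forall t, Om t [::] = 0) ->
  (forall t, a < t < b -> ncs_is_derive H t (Om t * H t)) ->
  (forall t, a < t < b -> ncs_is_derive K t (Om t * K t)) ->
  a < t0 < b -> K t0 [::] = 1 ->
  forall t, a < t < b -> H t = K t * ((K t0)^-1 * H t0).
Proof.
move=> Om0 dH dK ht0 K1 t ht; apply/eqP; rewrite -subr_eq0; apply/eqP.
apply: (@ode_unique_zero Om (fun t => H t - K t * ((K t0)^-1 * H t0)) a b t0) => //.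
  move=> x hx; apply: (ncs_derive_eq (ncs_deriveB (dH x hx) (ncs_deriveMr _ (dK x hx)))).
  by rewrite mulrBr !mulrA.
by rewrite mulrA mulrV ?mul1r ?subrr//; exact: ncs_unitE.
Qed.

Definition ncs_small n r := forall w, (size w < n)%N -> r w = 0.

Lemma ncs_smallMr f r n : ncs_small n r -> ncs_small n (r * f).
Proof.
move=> rn w wn; rewrite ncs_mulE big1// => k _; rewrite rn ?mul0r//.
by rewrite size_take; case: ifP => // kw; exact: ltn_trans wn.
Qed.

Lemma ncs_smallMl_lead f r n w : ncs_small n r -> f [::] = 1 -> size w = n ->
  (f * r) w = r w.
Proof.
move=> rn f1 wn; rewrite -{}wn in rn *.
rewrite ncs_mulE big_ord_recl take0 drop0 f1 mul1r big1 ?addr0// => k _.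
rewrite rn ?mulr0// size_drop ltn_subrL.
by rewrite (leq_ltn_trans _ (ltn_ord k)).
Qed.

Lemma ncs_smallMr_lead f r n w : ncs_small n r -> f [::] = 1 -> size w = n ->
  (r * f) w = r w.
Proof.
move=> rn f1 wn; rewrite -{}wn in rn *.
rewrite ncs_mulE big_ord_recr/= take_size drop_size f1 mulr1.
by rewrite big1 ?add0r// => k _; rewrite rn ?mul0r// size_take ltn_ord.
Qed.

(** Two solutions with the same regularized limit agree. One would like to let x
    tend to the end point in E c E', but E may diverge: the coefficients of x^A
    are powers of ln x, up to factorials. If c - 1 vanishes on words shorter
    than n, then conjugation by E leaves the coefficients of length n of c - 1
    unchanged, so these can be read off in the limit; hence an induction on n. *)
Lemma asymptotic_unique (F : set_system R) {PF : ProperFilter F} H K E E' c :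
  (forall x, E' x * E x = 1) -> (forall x, E x [::] = 1) ->
  (forall x, E' x [::] = 1) -> (forall x, K x [::] = 1) ->
  (\forall x \near F, H x = K x * c) ->
  ncs_cvg (fun x => H x * E' x) F 1 -> ncs_cvg (fun x => K x * E' x) F 1 -> c = 1.
Proof.
move=> EE E1 E'1 K1 HK cH cK; apply/funext => w.
have [n] := ubnP (size w); elim: n w => // n IH w wn.
have rn : ncs_small n (c - 1).
  by move=> v vn; rewrite ncs_addE ncs_oppE IH// subrr.
have [wn'|wn'] := ltnP (size w) n; first exact: IH.
have {wn' wn} wn : size w = n by apply/eqP; rewrite eqn_leq wn' andbT -ltnS.
have cw : ccvg F (fun x => (K x * E' x) w + (c - 1) w) ((1 : ncs R L) w).
  have FF : Filter F by exact: PF.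
  apply: (@ccvg_near _ _ F FF (fun x => (H x * E' x) w)); last exact: cH.
  apply: filterS HK => x ->.
  have {1}-> : c = 1 + (c - 1) by rewrite addrC subrK.
  rewrite mulrDr mulr1 mulrDl ncs_addE; congr (_ + _).
  have n1 := ncs_smallMr (E' x) rn.
  by rewrite -mulrA (ncs_smallMl_lead n1)// (ncs_smallMr_lead rn).
have cw' : ccvg F (fun x => (K x * E' x) w + (c - 1) w) ((1 : ncs R L) w + (c - 1) w).
  by apply: ccvgD; [exact: cK|exact: ccvg_cst].
by have := ccvg_unique cw cw'; rewrite ncs_addE ncs_oppE addrC subrK => <-.
Qed.

Lemma cder_letter_exp (l : L) (lam : R -> R[i]) t d : cder lam t d ->
  ncs_is_derive (fun x => letter_exp l (lam x)) t
    (d *: (ncs_letter R l * letter_exp l (lam t))).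
Proof.
move=> hl w.
suff : cder (fun x => letter_exp l (lam x) w) t
  ((d *: (ncs_letter R l * letter_exp l (lam t))) w) by [].
case: w => [|l' w].
  under eq_fun do rewrite letter_exp_nil.
  by rewrite ncs_scaleE ncs_mul_nil mul0r mulr0; exact: cder_cst.
rewrite ncs_scaleE ncs_letter_mul_cons /letter_exp/=.
have [<-|] := eqVneq l' l; last first.
  by move=> _ /=; rewrite mul0r mulr0; exact: cder_cst.
case: ifP => /= _; last by rewrite mulr0 mulr0; exact: cder_cst.
apply: (cder_eq (cderM (cderX _ hl) (cder_cst _ t))).
rewrite mulr0 addr0 mul1r factS natrM -(mulr_natr (lam t ^+ _)).
have n0 := natSr_neq0 R (size w).
have n1 : (size w)`!%:R != 0 :> R[i] by rewrite pnatr_eq0 -lt0n fact_gt0.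
by field; rewrite n1 addrC natr1.
Qed.

End SeriesCalculus.

(** * The holomorphic factor of the solution at 0 *)

Section Holomorphic.
Context (R : realType).
Local Notation series := (ncs R f5_letter).
Implicit Types (w : seq f5_letter) (z : R[i]) (g lam : R -> R[i]) (t : R).

Definition pole (l : f5_letter) z : R[i] :=
  if l is Some k then (z - mu4 R k)^-1 else z^-1.

(** [f5_connection] at a complex point. *)
Definition f5_conn z : series :=
  z^-1 *: f5_A R + \sum_(k < 4) (z - mu4 R k)^-1 *: f5_b R k.

Lemma f5_conn_nil z : f5_conn z [::] = 0.
Proof.
rewrite /f5_conn ncs_addE ncs_scaleE mulr0 add0r ncs_sumE big1// => k _.
by rewrite ncs_scaleE mulr0.
Qed.

Lemma f5_conn_mul_cons z (f : series) l w :
  (f5_conn z * f) (l :: w) = pole l z * f w.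
Proof.
rewrite /f5_conn mulrDl mulr_suml ncs_addE ncs_sumE -scalerAl ncs_scaleE.
rewrite ncs_letter_mul_cons.
have E (k : 'I_4) : ((z - mu4 R k)^-1 *: f5_b R k * f) (l :: w) =
    (z - mu4 R k)^-1 * ((l == Some k)%:R * f w).
  by rewrite -scalerAl ncs_scaleE ncs_letter_mul_cons.
rewrite (eq_bigr _ (fun k _ => E k)); case: l {E} => [k|] /=.
  rewrite mul0r mulr0 add0r (bigD1 k)//= eqxx mul1r big1 ?addr0// => j jk.
  by rewrite (inj_eq Some_inj) eq_sym (negbTE jk) mul0r mulr0.
by rewrite mul1r big1 ?addr0// => k _; rewrite mul0r mulr0.
Qed.

Definition int_letter (l : f5_letter) (a : nat -> R[i]) : nat -> R[i] :=
  if l is Some k then int_pole (mu4 R k) a else int0 a.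

(** Writing H_0 = F(z) exp(A log z), the equation for F is
    F' = omega F - F A / z. Its coefficient at a word l w is the sum of
    F_w / (z - zeta_l) and, when the word ends with A, of - F_w' / z where w' is
    the word deprived of its last letter. Only shorter words occur on the right,
    hence the definition by recursion on the length; [n] is the length of the
    word. *)
Fixpoint hol_rec (n : nat) w : nat -> R[i] :=
  match n, w with
  | n.+1, l :: w' => fun m => int_letter l (hol_rec n w') m -
      (last l w' == None)%:R * int0 (hol_rec n (belast l w')) m
  | _, _ => fun m => (m == 0%N)%:R
  end.
Definition hol_coef w := hol_rec (size w) w.

Lemma hol_coef_cons l w m : hol_coef (l :: w) m =
  int_letter l (hol_coef w) m - (last l w == None)%:R * int0 (hol_coef (belast l w)) m.
Proof. by rewrite /hol_coef size_belast. Qed.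

Lemma hol_coef0 w : hol_coef w 0%N = (1 : series) w.
Proof.
case: w => [//|l w]; rewrite hol_coef_cons.
by case: l => [k|]; rewrite /= /int0 /int_pole invr0 !mulr0 subr0.
Qed.

Lemma normc_mu4 (k : 'I_4) : normc (mu4 R k) = 1.
Proof.
rewrite /mu4 normcX [normc 'i%C](_ : _ = 1) ?expr1n//.
by rewrite /= expr0n add0r expr1n sqrtr1.
Qed.

Lemma bdd_int_letter l a : bdd a -> bdd (int_letter l a).
Proof.
case: l => [k|] abd /=; [exact: (bdd_int_pole (normc_mu4 k))|exact: bdd_int0].
Qed.

Lemma bddM c a : bdd a -> bdd (fun n => c * a n : R[i]).
Proof.
move=> [B aB]; exists (normc c * B) => n.
by rewrite normcM ler_wpM2l// normc_ge0.
Qed.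

Lemma bdd_hol_coef w : bdd (hol_coef w).
Proof.
have [n] := ubnP (size w); elim: n w => // n IH [|l w] wn.
  exists 1 => m; rewrite [hol_coef _ _](_ : _ = (m == 0%N)%:R)//.
  by case: eqP => _; rewrite ?normc1 ?normc0 ?ler01.
have -> : hol_coef (l :: w) = fun m => int_letter l (hol_coef w) m -
    (last l w == None)%:R * int0 (hol_coef (belast l w)) m.
  by apply/funext => m; exact: hol_coef_cons.
apply: bddB; first by apply: bdd_int_letter; exact: IH.
by apply: bddM; apply: bdd_int0; apply: IH; rewrite size_belast.
Qed.

Definition hol z : series := fun w => pval (hol_coef w) z.

Lemma hol0 : hol 0 = 1.
Proof. by apply/funext => w; rewrite /hol pval_at0 hol_coef0. Qed.

Lemma hol_nil z : normc z < 1 -> hol z [::] = 1.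
Proof.
move=> z1; apply: (ccvg_unique (pval_cvg (bdd_hol_coef [::]) z1)).
apply: ccvg_shiftS.
rewrite (_ : (fun n => _) = fun=> 1); first exact: ccvg_cst.
apply/funext => n; rewrite /psum big_ord_recl big1 => [|k _].
  by rewrite addr0 mul1r expr0.
by rewrite mul0r.
Qed.

Lemma ccvg_linB (u v : nat -> R[i]) l m c : ccvg \oo u l -> ccvg \oo v m ->
  ccvg \oo (fun n => u n - c * v n) (l - c * m).
Proof.
move=> ul vm; apply: ccvgD => //.
under eq_fun do rewrite -mulNr; rewrite -mulNr.
by apply: ccvgM => //; exact: ccvg_cst.
Qed.

Lemma dpsum_lin (a b : nat -> R[i]) c z N :
  dpsum (fun n => a n - c * b n) z N = dpsum a z N - c * dpsum b z N.
Proof.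
rewrite /dpsum mulr_sumr -sumrB; apply: eq_bigr => n _.
by rewrite mulrBl mulrA.
Qed.

(** The two poles at 0 are harmless: F_w vanishes at 0 for nonempty w, and for
    the word A the two terms 1/z cancel. *)
Lemma hol_ode g t (g' : R[i]) : cder g t g' -> normc (g t) < 1 -> g t != 0 ->
  ncs_is_derive (fun x => hol (g x)) t
    (g' *: (f5_conn (g t) * hol (g t) - (g t)^-1 *: (hol (g t) * f5_A R))).
Proof.
move=> dg z1 z0 w.
suff : cder (fun x => hol (g x) w) t
  ((g' *: (f5_conn (g t) * hol (g t) - (g t)^-1 *: (hol (g t) * f5_A R))) w) by [].
set z := g t in z1 z0 *.
apply: (@cder_eq _ _ _ ((f5_conn z * hol z - z^-1 *: (hol z * f5_A R)) w * g'));
  last by rewrite ncs_scaleE mulrC.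
apply: cder_pval => //; first exact: bdd_hol_coef.
case: w => [|l w].
  rewrite ncs_addE ncs_oppE ncs_scaleE !ncs_mul_nil f5_conn_nil mul0r mulr0 mulr0 subr0.
  apply: ccvg_shiftS.
  rewrite (_ : (fun n => _) = fun=> 0); first exact: ccvg_cst.
  apply/funext => n; rewrite /dpsum big_ord_recl mulr0n mulr0 add0r big1// => k _.
  by rewrite mul0r.
rewrite ncs_addE ncs_oppE ncs_scaleE f5_conn_mul_cons.
rewrite [l :: w in X in _ - X]lastI /f5_A ncs_mul_letter_rcons.
rewrite (_ : dpsum _ _ = fun N =>
    dpsum (int_letter l (hol_coef w)) z N - (last l w == None)%:R *
    dpsum (int0 (hol_coef (belast l w))) z N); last first.
  apply/funext => N; rewrite -dpsum_lin; apply: eq_bigr => n _.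
  by rewrite hol_coef_cons.
have c0 v := dpsum_int0_cvg (bdd_hol_coef v) z1 z0.
have cl : ccvg \oo (dpsum (int_letter l (hol_coef w)) z)
   (pole l z * (hol z w - (l == None)%:R * hol_coef w 0%N)).
  case: l => [k|] /=; last by rewrite mul1r; exact: c0.
  rewrite mul0r subr0; apply: dpsum_int_pole_cvg => //; first exact: normc_mu4.
  exact: bdd_hol_coef.
have := ccvg_linB ((last l w == None)%:R) cl (c0 (belast l w)).
rewrite !hol_coef0 /hol; congr (ccvg _ _ _).
case: w {cl} => [|l' w] /=; last first.
  by rewrite ncs_oneE !mulr0 !subr0; ring.
by rewrite !ncs_oneE; case: l => [k|] /=; ring.
Qed.

(** The point 0 is not covered by [hol_ode], but the power series are still
    differentiable there, hence continuous. *)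
Lemma hol_cvg0 g t (g' : R[i]) : cder g t g' -> g t = 0 ->
  ncs_cvg (fun x => hol (g x)) (nbhs t) 1.
Proof.
move=> dg g0; rewrite -hol0 -g0.
apply: (@ncs_derive_cvg _ _ (fun x => hol (g x)) t (fun w => hol_coef w 1%N * g')) => w.
suff : cder (fun x => hol (g x) w) t (hol_coef w 1%N * g') by [].
apply: cder_pval => //; first exact: bdd_hol_coef.
  by rewrite g0 normc0.
by rewrite g0; exact: dpsum_at0.
Qed.

(** The branch of the logarithm is left free, because one is needed on the right
    half plane and another on the upper half plane. *)
Lemma hol_log_ode g lam t (g' : R[i]) : cder g t g' -> cder lam t ((g t)^-1 * g') ->
  normc (g t) < 1 -> g t != 0 ->
  ncs_is_derive (fun x => hol (g x) * letter_exp None (lam x)) t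
    (g' *: f5_conn (g t) * (hol (g t) * letter_exp None (lam t))).
Proof.
move=> dg dl z1 z0.
apply: (ncs_derive_eq (ncs_deriveM (hol_ode dg z1 z0) (cder_letter_exp None dl))).
rewrite -!scalerAl -!scalerAr mulrBl scalerBr -!scalerAl !mulrA /f5_A.
by rewrite scalerA [g' * _]mulrC subrK.
Qed.

End Holomorphic.

(** * The symmetry of order 3 *)

Section Symmetry.
Context (R : realType).
Local Notation series := (ncs R f5_letter).
Local Notation s := (@f5_s R).

Lemma f5_s_letter_nil l : f5_s_letter R l [::] = 0.
Proof.
case: l => [[[|[|[|[|//]]]] ?]|]//=.
by rewrite /f5_C !(ncs_addE, ncs_oppE) ncs_sumE big1// !(subr0, oppr0).
Qed.
Local Notation s0 := f5_s_letter_nil.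

Lemma f5_sA : s (f5_A R) = f5_b1 R.
Proof. exact: (ncs_subst_letter (s0 _)). Qed.
Lemma f5_sb1 : s (f5_b1 R) = f5_bi R.
Proof. by rewrite /f5_s (ncs_subst_letter (s0 _))/= inordK. Qed.
Lemma f5_sbi : s (f5_bi R) = f5_A R.
Proof. by rewrite /f5_s (ncs_subst_letter (s0 _))/= inordK. Qed.
Lemma f5_sbm1 : s (f5_bm1 R) = f5_bmi R.
Proof. by rewrite /f5_s (ncs_subst_letter (s0 _))/= inordK. Qed.
Lemma f5_sbmi : s (f5_bmi R) = f5_C R.
Proof. by rewrite /f5_s (ncs_subst_letter (s0 _))/= inordK. Qed.

Lemma ord4_ind (P : 'I_4 -> Prop) :
  P (inord 0) -> P (inord 1) -> P (inord 2) -> P (inord 3) -> forall k, P k.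
Proof.
move=> P0 P1 P2 P3 [[|[|[|[|//]]]] hk].
- by rewrite (_ : Ordinal hk = inord 0)//; apply/val_inj; rewrite /= inordK.
- by rewrite (_ : Ordinal hk = inord 1)//; apply/val_inj; rewrite /= inordK.
- by rewrite (_ : Ordinal hk = inord 2)//; apply/val_inj; rewrite /= inordK.
- by rewrite (_ : Ordinal hk = inord 3)//; apply/val_inj; rewrite /= inordK.
Qed.

Lemma f5_s3 (f : series) : s (s (s f)) = f.
Proof.
apply: (ncs_subst_order3 s0) => -[k|]; last by rewrite -!/(f5_s _) f5_sb1 f5_sbi.
rewrite -!/(f5_s _) -[f5_s_letter R (Some k)](ncs_subst_letter (s0 _)) -!/(f5_s _).
rewrite -/(f5_b R k); elim/ord4_ind: k.
- by rewrite -/(f5_b1 R) f5_sb1 f5_sbi f5_sA.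
- by rewrite -/(f5_bi R) f5_sbi f5_sA f5_sb1.
- by rewrite -/(f5_bm1 R) f5_sbm1 f5_sbmi f5_s_C.
- by rewrite -/(f5_bmi R) f5_sbmi f5_s_C f5_sbm1.
Qed.

Lemma sum_ord4 (V : nmodType) (F : 'I_4 -> V) : \sum_(k < 4) F k =
  F (inord 0) + F (inord 1) + F (inord 2) + F (inord 3).
Proof.
rewrite !big_ord_recr big_ord0/= add0r.
by congr (F _ + F _ + F _ + F _); apply/val_inj; rewrite /= inordK.
Qed.

Lemma f5_connE z : f5_conn z = z^-1 *: f5_A R + ((z - 1)^-1 *: f5_b1 R +
   (z - 'i%C)^-1 *: f5_bi R + (z + 1)^-1 *: f5_bm1 R + (z + 'i%C)^-1 *: f5_bmi R).
Proof.
rewrite /f5_conn sum_ord4 /mu4 !inordK// expr0 expr1 sqr_i exprS sqr_i mulrN1 !opprK.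
by [].
Qed.

(** The inverse of the map sigma with 0 -> 1 -> i -> 0 and -1 -> -i -> oo -> -1;
    [dmoebius] is its derivative. *)
Definition moebius (w : R[i]) : R[i] := 'i%C * ((1 - w) / (1 + w)).
Definition dmoebius (w : R[i]) : R[i] := - 2 * 'i%C / (1 + w) ^+ 2.

(** The pullback of the connection form by [moebius], with residues moved by
    [f5_s], is the form itself: the logarithmic derivatives of the numerators of
    [moebius w - zeta] give the poles other than -1, and the common denominator
    1 + w collects - (A + b[1] + b[i] + b[-i]) - C = b[-1] at -1. *)
Lemma s_f5_conn w : w != 0 -> w != 1 -> w != 'i%C -> w != - 1 -> w != - 'i%C ->
  dmoebius w *: s (f5_conn (moebius w)) = f5_conn w.
Proof.
move=> w0 w1 wi wm wmi.
have ii : 'i%C * 'i%C = -1 :> R[i] by rewrite -expr2 sqr_i.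
have i0 : 'i%C != 0 :> R[i].
  by apply/eqP => h; move/eqP: ii; rewrite h mul0r eq_sym oppr_eq0 oner_eq0.
rewrite -subr_eq0 in w1; rewrite -subr_eq0 in wi; rewrite -addr_eq0 in wmi.
rewrite -addr_eq0 in wm.
have w1' : 1 - w != 0 by rewrite -opprB oppr_eq0.
have wm' : 1 + w != 0 by rewrite addrC.
have two0 : 2 != 0 :> R[i] by rewrite pnatr_eq0.
have i1 : 1 + 'i%C != 0 :> R[i].
  by apply/eqP => /(congr1 (@complex.Im _))/eqP; rewrite /= add0r oner_eq0.
have i1' : 1 - 'i%C != 0 :> R[i].
  by apply/eqP => /(congr1 (@complex.Im _))/eqP; rewrite /= add0r oppr_eq0 oner_eq0.
rewrite f5_connE /f5_s !ncs_substD !ncs_substZ -!/(f5_s _).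
rewrite f5_sA f5_sb1 f5_sbi f5_sbm1 f5_sbmi !scalerDr !scalerA.
have -> : dmoebius w / moebius w = (w - 1)^-1 - (w + 1)^-1.
  by rewrite /dmoebius /moebius; field; rewrite ?i0 ?w1' ?wm' ?w1 ?wm.
have -> : dmoebius w / (moebius w - 1) = (w - 'i%C)^-1 - (w + 1)^-1.
  have -> : moebius w - 1 = - (1 + 'i%C) * (w - 'i%C) / (1 + w).
    by rewrite /moebius; field: ii.
  rewrite /dmoebius; field: ii; rewrite ?i1 ?wi ?wm ?wm'; done.
have -> : dmoebius w / (moebius w - 'i%C) = w^-1 - (w + 1)^-1.
  have -> : moebius w - 'i%C = - 2 * 'i%C * w / (1 + w) by rewrite /moebius; field.
  by rewrite /dmoebius; field; rewrite ?i0 ?wm' ?wm ?w0.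
have -> : dmoebius w / (moebius w + 1) = (w + 'i%C)^-1 - (w + 1)^-1.
  have -> : moebius w + 1 = (1 - 'i%C) * (w + 'i%C) / (1 + w).
    by rewrite /moebius; field: ii.
  rewrite /dmoebius; field: ii; rewrite ?i1' ?wmi ?wm ?wm'; done.
have -> : dmoebius w / (moebius w + 'i%C) = - (w + 1)^-1.
  have -> : moebius w + 'i%C = 2 * 'i%C / (1 + w) by rewrite /moebius; field.
  by rewrite /dmoebius; field; rewrite ?i0 ?wm' ?wm.
rewrite /f5_C sum_ord4 -/(f5_b1 R) -/(f5_bi R) -/(f5_bm1 R) -/(f5_bmi R) f5_connE.
apply/funext => v; rewrite !(ncs_addE, ncs_scaleE, ncs_oppE).
ring.
Qed.

End Symmetry.

(** * The principal logarithm *)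

Section PrincipalLog.
Context (R : realType).

(** The difference of two arguments of the same number in ]-pi, pi[ is 2 e with
    -pi < e < pi and cos (2 e) = 1, so sin e = 0 and e = 0. *)
Lemma cexp_inj (l m : R[i]) : - pi < complex.Im l < pi -> - pi < complex.Im m < pi ->
  cexp l = cexp m -> l = m.
Proof.
case: l m => [a b] [c d] /= /andP[b1 b2] /andP[d1 d2]; rewrite /cexp.
move=> E; have := congr1 (@complex.Re R) E; have := congr1 (@complex.Im R) E.
rewrite /= !mul0r !subr0 !addr0 => h2 h1.
have ea := expR_gt0 a; have ec := expR_gt0 c.
have eac : expR a = expR c.
  have : expR a ^+ 2 = expR c ^+ 2.
    have -> : expR a ^+ 2 = (expR a * cos b) ^+ 2 + (expR a * sin b) ^+ 2.
      by rewrite !exprMn -mulrDr cos2Dsin2 mulr1.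
    by rewrite h1 h2 !exprMn -mulrDr cos2Dsin2 mulr1.
  by move/eqP; rewrite eqrXn2 ?ltW// => /eqP.
have ac : a = c by exact: expR_inj.
rewrite eac in h1 h2.
have hc : cos b = cos d by apply: (mulfI (lt0r_neq0 ec)).
have hs : sin b = sin d by apply: (mulfI (lt0r_neq0 ec)).
congr (_ +i* _) => //.
have c1 : cos (b - d) = 1 by rewrite cosB hc hs -!expr2 cos2Dsin2.
pose e := (b - d) / 2.
have s0 : sin e = 0.
  have : cos (e *+ 2) = 1 by rewrite /e -mulr_natr divfK.
  rewrite cos_mulr2n cos2sin2 => /eqP.
  rewrite mulrnBl -[1 *+ 2]/(1 + 1) => h.
  have : sin e ^+ 2 = 0 by move/eqP: h; rewrite -mulr_natr; lra.
  by move/eqP; rewrite sqrf_eq0 => /eqP.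
have [e0|e0|e0] := ltrgtP e 0.
- have : 0 < sin (- e) by apply: sin_gt0_pi; rewrite /e in e0 *; lra.
  by rewrite sinN s0 oppr0 ltxx.
- have : 0 < sin e by apply: sin_gt0_pi; rewrite /e in e0 *; lra.
  by rewrite s0 ltxx.
- by move: e0; rewrite /e; lra.
Qed.

Lemma clnE (l a : R[i]) : cexp l = a -> - pi < complex.Im l < pi -> cln a = l.
Proof.
move=> la hl; rewrite /cln.
have ex : exists x, [set l : R[i] | cexp l = a /\ - pi < complex.Im l < pi] x.
  by exists l.
have [h1 h2] := xgetPex 0 ex.
by apply: cexp_inj => //; rewrite h1.
Qed.

Lemma cln_real (x : R) : 0 < x -> cln x%:C = (ln x)%:C.
Proof.
move=> x0; apply: clnE; last by rewrite /= oppr_lt0 pi_gt0.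
by rewrite /cexp/= lnK ?posrE// cos0 sin0 mulr1.
Qed.

(** The exponent ln (2 / i). *)
Definition kappa : R[i] := ln 2 +i* (- (pi / 2)).

Lemma cln_2_div_i : cln (2 / 'i%C) = kappa.
Proof.
have pi0 := pi_gt0 R.
apply: clnE; last by rewrite /=; lra.
rewrite /cexp/= lnK ?posrE// cosN sinN cos_pihalf sin_pihalf.
have i0 : 'i%C != 0 :> R[i].
  by apply/eqP => /(congr1 (@complex.Im _))/eqP; rewrite /= oner_eq0.
apply: (mulIf i0); rewrite divfK//.
apply: complex_ext => /=; ring.
Qed.

Lemma cpow_letter (L : finType) (a : R[i]) (l : L) :
  cpow_ncs a (ncs_letter R l) = letter_exp l (cln a).
Proof. exact: ncs_exp_letter. Qed.

Lemma cpow_letterN (L : finType) (a : R[i]) (l : L) :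
  cpow_ncs a (- ncs_letter R l) = letter_exp l (- cln a).
Proof. by rewrite /cpow_ncs scalerN -scaleNr ncs_exp_letter. Qed.

Lemma clog_real (x : R) : 0 < x -> clog x%:C = (ln x)%:C.
Proof.
move=> x0; rewrite /clog /sqnorm/= mul0r atan0 expr0n addr0 expr2 lnM//.
by congr (_ +i* _); lra.
Qed.

End PrincipalLog.

(** * Two solutions on the right half disc *)

Section HalfDisc.
Context (R : realType).
Implicit Types (w z : R[i]) (g : R -> R[i]) (t : R).

Definition half_disc w : Prop := 0 < complex.Re w /\ sqnorm w < 1.

(** The quotient of [moebius w] by i; it maps [half_disc] to itself, so that
    log (moebius w) = clog (cayley w) + i pi / 2 is a logarithm on the upper
    half disc. *)
Definition cayley w : R[i] := (1 - w) / (1 + w).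

Lemma normc_lt1 w : sqnorm w < 1 -> normc w < 1.
Proof.
by move=> w1; rewrite -(@ltr_pXn2r _ 2) ?nnegrE ?normc_ge0// normc_sqnorm expr1n.
Qed.

Lemma Re_gt0_neq0 w : 0 < complex.Re w -> w != 0.
Proof. by move=> w0; apply/eqP => h; move: w0; rewrite h ltxx. Qed.

Lemma half_disc_moebius w : half_disc w ->
  [/\ 1 + w != 0, 0 < complex.Re (cayley w), sqnorm (moebius w) < 1 & moebius w != 0].
Proof.
case: w => a b [a0 w1]; rewrite /sqnorm/= in a0 w1.
have w0 : 1 + (a +i* b) != 0 by apply: Re_gt0_neq0; rewrite Re_add/=; lra.
have n0 : 0 < (1 + a) ^+ 2 + b ^+ 2 by rewrite ltr_pwDl ?sqr_ge0// exprn_gt0//; lra.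
have i0 : 'i%C != 0 :> R[i].
  by apply/eqP => /(congr1 (@complex.Im _))/eqP; rewrite /= oner_eq0.
have c0 : 0 < complex.Re (cayley (a +i* b)).
  rewrite /cayley !(Re_mul, Re_inv, Im_inv, Re_add, Im_add, Re_opp, Im_opp)/= add0r.
  rewrite [X in 0 < X](_ : _ = (1 - (a ^+ 2 + b ^+ 2)) / ((1 + a) ^+ 2 + b ^+ 2)).
    by rewrite divr_gt0// subr_gt0.
  by rewrite add0r; field; rewrite lt0r_neq0.
split => //.
- rewrite /moebius sqnormM [sqnorm 'i%C](_ : _ = 1) ?mul1r; last first.
    by rewrite /sqnorm/= expr0n expr1n add0r.
  rewrite /sqnorm !(Re_mul, Im_mul, Re_inv, Im_inv, Re_add, Im_add, Re_opp, Im_opp)/= !add0r.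
  rewrite [X in X < 1](_ : _ = ((1 - a) ^+ 2 + b ^+ 2) / ((1 + a) ^+ 2 + b ^+ 2)).
    by rewrite ltr_pdivrMr// mul1r; nra.
  by field; rewrite lt0r_neq0.
- by rewrite /moebius mulf_neq0//; exact: Re_gt0_neq0 c0.
Qed.

Definition K0 w := hol w * letter_exp None (clog w).

(** The image by [f5_s] of the solution at 0, transported to the point 1. *)
Definition K1 w := f5_s (hol (moebius w) * letter_exp None (clog (cayley w) + (pi / 2)*i)).

Lemma K0_ode g t (g' : R[i]) : cder g t g' -> half_disc (g t) ->
  ncs_is_derive (fun x => K0 (g x)) t (g' *: f5_conn (g t) * K0 (g t)).
Proof.
move=> dg [h1 h2]; apply: hol_log_ode => //.
- exact: cder_clog.
- exact: normc_lt1.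
- exact: Re_gt0_neq0.
Qed.

Lemma cder_cayley g t (g' : R[i]) : cder g t g' -> 1 + g t != 0 ->
  cder (fun x => cayley (g x)) t (- 2 / (1 + g t) ^+ 2 * g').
Proof.
move=> dg n0.
have d1 := cderD (cder_cst 1 t) dg; have d2 := cderD (cder_cst 1 t) (cderN dg).
have dV := cderV (f := fun x => 1 + g x) n0 d1.
by apply: (cder_eq (cderM d2 dV)); field.
Qed.

Lemma cder_moebius g t (g' : R[i]) : cder g t g' -> 1 + g t != 0 ->
  cder (fun x => moebius (g x)) t (dmoebius (g t) * g').
Proof.
move=> dg n0; apply: (cder_eq (cderZ 'i%C (cder_cayley dg n0))).
by rewrite /dmoebius; ring.
Qed.

Lemma K1_ode g t (g' : R[i]) : cder g t g' -> half_disc (g t) ->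
  ncs_is_derive (fun x => K1 (g x)) t (g' *: f5_conn (g t) * K1 (g t)).
Proof.
move=> dg hd; have [n0 c0 r1 r0] := half_disc_moebius hd; have [h1 h2] := hd.
have i0 : 'i%C != 0 :> R[i].
  by apply/eqP => /(congr1 (@complex.Im _))/eqP; rewrite /= oner_eq0.
have dl : cder (fun x => clog (cayley (g x)) + (pi / 2)*i) t
    ((moebius (g t))^-1 * (dmoebius (g t) * g')).
  apply: (cder_eq (cderD (cder_clog c0 (cder_cayley dg n0)) (cder_cst _ t))).
  rewrite addr0 /moebius -/(cayley (g t)) /dmoebius.
  have := Re_gt0_neq0 c0; move: (cayley _) => u u0.
  by field; rewrite i0 u0 n0.
have := ncs_derive_subst (f5_s_letter R) (hol_log_ode (cder_moebius dg n0) dl (normc_lt1 r1) r0).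
rewrite (ncs_substM (@f5_s_letter_nil R)) -!/(f5_s _) -/(K1 (g t)) => h.
apply: (ncs_derive_eq h); congr (_ * _).
rewrite [f5_s _](ncs_substZ (f5_s_letter R)) -/(f5_s _) mulrC -scalerA s_f5_conn//.
- exact: Re_gt0_neq0.
- by apply/eqP => h'; move: h2; rewrite h' /sqnorm/= expr1n expr0n addr0 ltxx.
- by apply/eqP => h'; move: h1; rewrite h' /= ltxx.
- by apply/eqP => h'; move: h1; rewrite h' /=; lra.
- by apply/eqP => h'; move: h1; rewrite h' /= oppr0 ltxx.
Qed.

Lemma K0_nil w : half_disc w -> K0 w [::] = 1.
Proof.
move=> [_ /normc_lt1 w1].
by rewrite /K0 ncs_mul_nil hol_nil// letter_exp_nil mulr1.
Qed.

Lemma K1_nil w : half_disc w -> K1 w [::] = 1.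
Proof.
move=> /half_disc_moebius[_ _ /normc_lt1 w1 _].
rewrite /K1 /f5_s (ncs_subst_nil (@f5_s_letter_nil R)).
by rewrite ncs_mul_nil hol_nil// letter_exp_nil mulr1.
Qed.

(** The fixed point of [moebius] in the half disc is c (1 + i) with
    2 c^2 + 2 c = 1. *)
Definition cfix : R := (Num.sqrt 3 - 1) / 2.
Definition fixpt : R[i] := cfix +i* cfix.

Lemma cfix_eq : 2 * cfix ^+ 2 + 2 * cfix = 1.
Proof.
have := sqr_sqrtr (ler0n R 3); rewrite /cfix; move: (Num.sqrt _) => q q3.
have -> : 2 * ((q - 1) / 2) ^+ 2 + 2 * ((q - 1) / 2) = (q ^+ 2 - 1) / 2 by field.
by rewrite q3; lra.
Qed.

Lemma cfix_gt0 : 0 < cfix.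
Proof.
rewrite /cfix divr_gt0// subr_gt0.
by rewrite -[X in X < _]sqrtr1 ltr_sqrt// ltr1n.
Qed.

(** Besides [moebius fixpt = fixpt], this needs the two branches of the logarithm
    to agree at the fixed point: pi / 4 = - pi / 4 + pi / 2. *)
Lemma K1_fixpt : K1 fixpt = f5_s (K0 fixpt).
Proof.
have c0 := cfix_gt0; have ce := cfix_eq.
have w0 : 1 + fixpt != 0 by apply: Re_gt0_neq0; rewrite Re_add/=; lra.
have cay : cayley fixpt = cfix -i* cfix.
  rewrite /cayley; apply: (mulIf w0); rewrite divfK//.
  by apply: complex_ext; rewrite /=; nra.
have rt : moebius fixpt = fixpt.
  rewrite /moebius -/(cayley fixpt) cay; apply: complex_ext => /=; ring.
rewrite /K1 /K0 rt cay; congr (f5_s (_ * letter_exp _ _)).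
rewrite /clog /sqnorm/= sqrrN mulNr divff ?lt0r_neq0// atanN atan1.
by apply: complex_ext => /=; rewrite ?addr0//; lra.
Qed.

End HalfDisc.

(** * Comparison with the normalized solutions on ]0, 1[ *)

Section Boundary.
Context (R : realType).
Local Notation series := (ncs R f5_letter).
Implicit Types (H : R -> series).

Lemma cder_real (t : R) : cder (fun x => x%:C) t 1.
Proof. by split => /=; [exact: is_derive_id|exact: is_derive_cst]. Qed.

Lemma half_disc_real (x : R) : 0 < x < 1 -> half_disc x%:C.
Proof.
move=> /andP[x0 x1]; split => //; rewrite /sqnorm/= expr0n addr0.
by rewrite expr_lt1// ltW.
Qed.

Lemma f5_solution_ode H : f5_solution H -> forall t, 0 < t < 1 ->
  ncs_is_derive H t (f5_conn t%:C * H t) /\ H t [::] = 1.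
Proof.
move=> HH t ht; have [[x _ xH] [dH dHH e]] := HH t ht.
have H1 : H t [::] = 1.
  by rewrite -xH /ncs_exp big_ord1 expr0 fact0 invr1 mul1r.
split => //; apply: (ncs_derive_eq dHH).
by rewrite -[f5_conn _]e divrK//; exact: ncs_unitE.
Qed.

Lemma ncs_cvg_near (F : set_system R) {FF : Filter F} H K (f : series) :
  (\forall x \near F, H x = K x) -> ncs_cvg H F f -> ncs_cvg K F f.
Proof.
move=> HK Hf w; apply: (@ccvg_near _ _ F FF (fun x => H x w)); last exact: Hf.
by apply: filterS HK => x ->.
Qed.

Lemma ncs_cvg_letter_exp (F : set_system R) {FF : Filter F} (l : f5_letter)
    (lam : R -> R[i]) c : ccvg F lam c ->
  ncs_cvg (fun x => letter_exp l (lam x)) F (letter_exp l c).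
Proof.
move=> h w; suff : ccvg F (fun x => letter_exp l (lam x) w) (letter_exp l c w) by [].
rewrite /letter_exp; case: ifP => _; last exact: ccvg_cst.
by apply: ccvgM; [exact: ccvgX|exact: ccvg_cst].
Qed.

(** Near 0 the factor [hol] tends to 1, so [K0] has the normalization of H_0. *)
Lemma H0_eq_K0 H : is_H0 H -> forall x, 0 < x < 1 -> H x = K0 x%:C.
Proof.
move=> [/f5_solution_ode hs hc].
have h12 : 0 < (2^-1 : R) < 1 by lra.
set c := (K0 (2^-1)%:C)^-1 * H 2^-1.
have HK x : 0 < x < 1 -> H x = K0 x%:C * c.
  apply: (ode_unique (Om := fun t => 1 *: f5_conn t%:C) (K := fun x => K0 x%:C)) => //.
  - by move=> t; rewrite ncs_scaleE f5_conn_nil mulr0.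
  - by move=> t /hs[h _]; rewrite scale1r.
  - by move=> t ht; apply: K0_ode; [exact: cder_real|exact: half_disc_real].
  - by apply: K0_nil; exact: half_disc_real.
suff c1 : c = 1 by move=> x /HK ->; rewrite c1 mulr1.
have near01 : \forall x \near 0^'+, 0 < x < (1 : R).
  near=> x; apply/andP; split; near: x; first exact: nbhs_right_gt.
  exact: nbhs_right_lt.
pose E x : series := letter_exp None (ln x)%:C.
pose E' x : series := letter_exp None (- (ln x)%:C).
(* The value 1 outside ]0, 1[ makes the constant term equal to 1 everywhere. *)
pose F x : series := if 0 < x < 1 then K0 x%:C else 1.
apply: (@asymptotic_unique _ _ (0^'+) _ H F E E').
- by move=> x; exact: letter_expN.
- by move=> x; exact: letter_exp_nil.
- by move=> x; exact: letter_exp_nil.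
- move=> x; rewrite /F; case: ifP => // h; apply: K0_nil; exact: half_disc_real.
- by apply: filterS near01 => x hx; rewrite /F hx HK.
- apply: (ncs_cvg_near _ hc); apply: filterS near01 => x /andP[x0 _].
  by rewrite cpow_letterN cln_real.
apply: (@ncs_cvg_near _ _ (fun x => hol x%:C)).
  apply: filterS near01 => x hx; rewrite /F hx /K0 clog_real; last by case/andP: hx.
  by rewrite -mulrA -letter_expD subrr letter_exp0 mulr1.
have := hol_cvg0 (cder_real 0) erefl.
by move=> h w; have [h1 h2] := h w; split; apply: cvg_at_right_filter.
Unshelve. all: by end_near. Qed.

(** For x near 1, log (moebius x) = ln (1 - x) - ln (1 + x) + i pi / 2, and the
    constant i pi / 2 - ln 2 left in the limit is - [kappa]. *)
Lemma H1_eq_K1 H : is_H1 H -> forall x, 0 < x < 1 ->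
  H x = K1 x%:C * letter_exp (Some (inord 0)) (kappa R).
Proof.
move=> [/f5_solution_ode hs hc].
set k := letter_exp _ _.
have h12 : 0 < (2^-1 : R) < 1 by lra.
set c := (K1 (2^-1)%:C * k)^-1 * H 2^-1.
have k1 x : 0 < x < 1 -> (K1 x%:C * k) [::] = 1.
  move=> hx; rewrite ncs_mul_nil K1_nil; last exact: half_disc_real.
  by rewrite /k letter_exp_nil mulr1.
have HK x : 0 < x < 1 -> H x = K1 x%:C * k * c.
  apply: (ode_unique (Om := fun t => 1 *: f5_conn t%:C) (K := fun x => K1 x%:C * k)) => //.
  - by move=> t; rewrite ncs_scaleE f5_conn_nil mulr0.
  - by move=> t /hs[h _]; rewrite scale1r.
  - move=> t ht; rewrite mulrA; apply: ncs_deriveMr.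
    by apply: K1_ode; [exact: cder_real|exact: half_disc_real].
  - exact: k1.
suff c1 : c = 1 by move=> x /HK ->; rewrite c1 mulr1.
have near01 : \forall x \near 1^'-, 0 < x < (1 : R).
  near=> x; apply/andP; split; near: x; first exact: nbhs_left_gt.
  exact: nbhs_left_lt.
pose E x : series := letter_exp (Some (inord 0)) (ln (1 - x))%:C.
pose E' x : series := letter_exp (Some (inord 0)) (- (ln (1 - x))%:C).
(* The value 1 outside ]0, 1[ makes the constant term equal to 1 everywhere. *)
pose F x : series := if 0 < x < 1 then K1 x%:C * k else 1.
apply: (@asymptotic_unique _ _ (1^'-) _ H F E E').
- by move=> x; exact: letter_expN.
- by move=> x; exact: letter_exp_nil.
- by move=> x; exact: letter_exp_nil.
- by move=> x; rewrite /F; case: ifP => // h; exact: k1.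
- by apply: filterS near01 => x hx; rewrite /F hx HK.
- apply: (ncs_cvg_near _ hc); apply: filterS near01 => x /andP[_ x1].
  by rewrite cpow_letterN cln_real// subr_gt0.
apply: (@ncs_cvg_near _ _ (fun x => f5_s (hol (moebius x%:C)) *
   letter_exp (Some (inord 0)) (ln 2 - ln (1 + x))%:C)).
  apply: filterS near01 => x hx; rewrite /F hx /K1 [f5_s _ in RHS](ncs_substM (@f5_s_letter_nil R)).
  rewrite (letter_exp_subst _ (@f5_s_letter_nil R) (erefl : f5_s_letter R None = ncs_letter R _)).
  rewrite -/(f5_s _) -!mulrA -!letter_expD; congr (_ * letter_exp _ _).
  case/andP: hx => x0 x1.
  have -> : cayley x%:C = ((1 - x) / (1 + x))%:C :> R[i].
    by rewrite /cayley rmorphM fmorphV rmorphB rmorphD rmorph1.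
  rewrite clog_real ?divr_gt0 ?subr_gt0//; last by lra.
  rewrite ln_div ?posrE ?subr_gt0//; last by lra.
  by apply: complex_ext => /=; ring.
rewrite -[X in ncs_cvg _ _ X]mulr1; apply: ncs_cvgM.
  rewrite -(ncs_subst1 (@f5_s_letter_nil R)); apply: ncs_cvg_subst.
  have n0 : 1 + (1 : R)%:C != 0 :> R[i] by apply: Re_gt0_neq0; rewrite Re_add/=; lra.
  have r0 : moebius (1 : R)%:C = 0 :> R[i] by rewrite /moebius subrr mul0r mulr0.
  have h := hol_cvg0 (cder_moebius (cder_real 1) n0) r0.
  move=> w; have [h1 h2] := h w; split; exact: cvg_at_left_filter.
rewrite -(letter_exp0 R (Some (inord 0))); apply: ncs_cvg_letter_exp; split => /=; last exact: cvg_cst.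
rewrite -(subrr (ln 2)); apply: cvgB; first exact: cvg_cst.
apply: cvg_at_left_filter.
have -> : ln 2 = ln (1 + 1) :> R by [].
apply: (@continuous_comp _ _ _ (fun x : R => 1 + x) (@ln R)).
  by apply: cvgD; [exact: cvg_cst|exact: cvg_id].
by apply: continuous_ln.
Unshelve. all: by end_near. Qed.

End Boundary.

(** * The hexagon relation *)

Section Main.
Context (R : realType).
Local Notation series := (ncs R f5_letter).

(** A path inside the half disc from ]0, 1[, where H_0 and H_1 are known, to the
    fixed point. *)
Definition fixpath (t : R) : R[i] := cfix R +i* (cfix R * t).

Lemma cder_fixpath t : cder fixpath t (0 +i* cfix R).
Proof.
split => /=; first exact: is_derive_cst.
by apply: (is_derive_eq (is_deriveZ (cfix R) (is_derive_id t 1))); rewrite /GRing.scale/= mulr1.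
Qed.

Lemma K0_K1_fixpath : K0 (cfix R)%:C =
  K1 (cfix R)%:C * ((f5_s (K0 (fixpt R)))^-1 * K0 (fixpt R)).
Proof.
have c0 := cfix_gt0 R; have ce := cfix_eq R.
have hd t : - 1 < t < 2 -> half_disc (fixpath t).
  move=> /andP[t1 t2]; split => //; rewrite /sqnorm/= [(_ * t) ^+ 2]exprMn.
  have t4 : t ^+ 2 < 4.
    have : 0 < (2 - t) * (2 + t) by rewrite mulr_gt0//; lra.
    by rewrite expr2; lra.
  have c5 : cfix R ^+ 2 < 5^-1.
    rewrite ltNge; apply/negP => h.
    have : cfix R * cfix R <= 3 / 10 * (3 / 10) by rewrite ler_pM//; lra.
    by rewrite -expr2; lra.
  have : cfix R ^+ 2 * t ^+ 2 <= cfix R ^+ 2 * 4 by rewrite ler_wpM2l ?sqr_ge0 ?ltW.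
  by lra.
have f0 : fixpath 0 = (cfix R)%:C by rewrite /fixpath mulr0.
have f1 : fixpath 1 = fixpt R by rewrite /fixpath mulr1.
rewrite -K1_fixpt -f0 -f1.
apply: (@ode_unique _ _ (fun t => (0 +i* cfix R) *: f5_conn (fixpath t))
  (fun t => K0 (fixpath t)) (fun t => K1 (fixpath t)) (- 1) 2 1).
- by move=> t; rewrite ncs_scaleE f5_conn_nil mulr0.
- by move=> t ht; apply: K0_ode; [exact: cder_fixpath|exact: hd].
- by move=> t ht; apply: K1_ode; [exact: cder_fixpath|exact: hd].
- by lra.
- by apply: K1_nil; apply: hd; lra.
- by lra.
Qed.

(** Both sides are the constant K1^-1 K0: the left-hand side is its value on
    ]0, 1[, the right-hand side its value at the fixed point. *)
Lemma Psi4E (H0 H1 : R -> series) (hH0 : is_H0 H0) (hH1 : is_H1 H1) (z : R) :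
  0 < z < 1 -> letter_exp (Some (inord 0)) (kappa R) * ((H1 z)^-1 * H0 z) =
  (f5_s (K0 (fixpt R)))^-1 * K0 (fixpt R).
Proof.
move=> hz; set k := letter_exp _ _.
have [s0 _] := hH0; have [s1 _] := hH1.
have hc : 0 < cfix R < 1 by have := cfix_gt0 R; have := cfix_eq R; nra.
have HH : H0 (cfix R) = H1 (cfix R) * ((H1 z)^-1 * H0 z).
  apply: (@ode_unique _ _ (fun t => f5_conn t%:C) H0 H1 0 1 z) => //.
  - by move=> t; exact: f5_conn_nil.
  - by move=> t /(f5_solution_ode s0)[].
  - by move=> t /(f5_solution_ode s1)[].
  - by have [] := f5_solution_ode s1 hz.
have uK : K1 (cfix R)%:C \is a GRing.unit.
  by apply: ncs_unitE; apply: K1_nil; exact: half_disc_real.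
apply: (mulrI uK); rewrite -K0_K1_fixpath -(H0_eq_K0 hH0)// HH (H1_eq_K1 hH1 hc).
by rewrite mulrA.
Qed.

End Main.

Theorem proposition1p1 (R : realType) (H0 H1 : R -> ncs R f5_letter)
    (hH0 : is_H0 H0) (hH1 : is_H1 H1) (z : R) (hz : 0 < z < 1) :
  let Psi4 := (H1 z)^-1 * H0 z in
  let a : R[i] := 2 / 'i%C in
  cpow_ncs a (f5_A R) * f5_s (f5_s Psi4) *
  cpow_ncs a (f5_bi R) * f5_s Psi4 *
  cpow_ncs a (f5_b1 R) * Psi4 = 1.
Proof.
move=> Psi4 a; have := Psi4E hH0 hH1 hz; rewrite -/Psi4.
rewrite !cpow_letter /a cln_2_div_i.
set EA := letter_exp None _; set Ei := letter_exp (Some (inord 1)) _.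
set E1 := letter_exp (Some (inord 0)) _.
have g1 : K0 (fixpt R) [::] = 1.
  apply: K0_nil; split => /=; first exact: cfix_gt0.
  by rewrite /sqnorm/=; have := cfix_gt0 R; have := cfix_eq R; nra.
move: (K0 _) g1 => g g1 E.
have sM (f h : ncs R f5_letter) : f5_s (f * h) = f5_s f * f5_s h.
  exact: (ncs_substM (@f5_s_letter_nil R)).
have sV (f : ncs R f5_letter) : f [::] = 1 -> f5_s f^-1 = (f5_s f)^-1.
  exact: (ncs_substV (@f5_s_letter_nil R)).
have s1 (f : ncs R f5_letter) : f [::] = 1 -> f5_s f [::] = 1.
  by move=> f1; rewrite /f5_s (ncs_subst_nil (@f5_s_letter_nil R)).
have sE1 : f5_s E1 = Ei.
  by apply: (letter_exp_subst _ (@f5_s_letter_nil R)); rewrite /= inordK.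
have sEi : f5_s Ei = EA.
  by apply: (letter_exp_subst _ (@f5_s_letter_nil R)); rewrite /= inordK.
have sE : Ei * f5_s Psi4 = (f5_s (f5_s g))^-1 * f5_s g.
  by rewrite -sE1 -sM E sM sV// s1.
have ssE : EA * f5_s (f5_s Psi4) = g^-1 * f5_s (f5_s g).
  by rewrite -sEi -sM sE sM sV ?f5_s3//; exact: (s1 _ (s1 _ g1)).
rewrite ssE -[X in X * E1]mulrA sE -[LHS]mulrA E.
have u1 := ncs_unitE g1; have u2 := ncs_unitE (s1 _ g1).
have u3 := ncs_unitE (s1 _ (s1 _ g1)).
by rewrite !mulrA (mulrK u3) (mulrK u2) mulVr.
Qed.
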